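(* Let $k\ge 2$ and $n\ge 1$ be integers, and let $X$ be a $2$-colored point set in general position in $\mathbb{R}^2$. Suppose that $|X| = kn$ and that there are at least $n$ points in each of the two color classes. Then $X$ spans $n$ pairwise disjoint $2$-colorful $k$-islands.
   Context: A finite set in $\mathbb{R}^d$ is in general position if each of its subsets of size at most $d+1$ is affinely independent. A partition of a finite set $X$ into $m$ parts is called an $m$-coloring of $X$; the parts are called color classes, and $X$ is then called $m$-colored (color classes are in general allowed to be empty). A subset $Y\subseteq X$ is $j$-colorful if $Y$ contains points from at least $j$ distinct color classes. For a finite set $X\subset\mathbb{R}^d$ and $Y\subseteq X$, the convex hull $\operatorname{conv} Y$ is called an island spanned by $X$ if $X\cap \operatorname{conv} Y = Y$. It is called a $k$-island if in addition $|Y|=k$, and it is called $j$-colorful if $Y$ is $j$-colorful. Islands are pairwise disjoint if they (that is, the convex hulls) are pairwise disjoint as subsets of $\mathbb{R}^d$. *)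

(* Defs.v *)
From mathcomp Require Import all_boot all_order all_algebra.
From mathcomp Require Import finmap.
From mathcomp Require Import boolp classical_sets reals convex.

Set Implicit Arguments.
Unset Strict Implicit.
Unset Printing Implicit Defensive.

Import Order.TTheory GRing.Theory Num.Theory.

Local Open Scope ring_scope.
Local Open Scope fset_scope.
Local Open Scope classical_set_scope.

Section Islands.
Variables (R : realType) (d : nat).
Local Notation point := 'rV[R]_d.
Implicit Types (X Y : {fset point}).

(* The weights [a] are total functions; only their values on [Y] matter. *)
Definition affinely_independent Y : Prop :=
  forall a : point -> R,
    \sum_(y <- Y) a y = 0 -> \sum_(y <- Y) a y *: y = 0 ->
    forall y, y \in Y -> a y = 0.

Definition general_position X : Prop :=
  forall Y, (Y `<=` X)%fset -> (#|` Y| <= d.+1)%N -> affinely_independent Y.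

(* The intersection of all convex sets that contain [Y]. *)
Definition conv_hull Y : set point :=
  smallest (@convex_set R point) [set` Y].

(* [C i] is the [i]-th color class; classes may be empty. *)
Definition coloring m X (C : 'I_m -> {fset point}) : Prop :=
  X = \big[fsetU/fset0]_(i < m) C i /\
  forall i j : 'I_m, i != j -> [disjoint C i & C j]%fset.

Definition colorful m (C : 'I_m -> {fset point}) (j : nat) Y : Prop :=
  (j <= #|[set i : 'I_m | (Y `&` C i)%fset != fset0]%SET|)%N.

(* An island [conv_hull Y] is represented by [Y], which it determines as its
   trace on [X]. *)
Definition island X Y : Prop :=
  (Y `<=` X)%fset /\ [set` X] `&` conv_hull Y = [set` Y].

Definition kisland (k : nat) X Y : Prop := island X Y /\ #|` Y| = k.

End Islands.

(* Main.v *)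
Require Import Defs.
From mathcomp Require Import all_boot all_order all_algebra.
From mathcomp Require Import finmap.
From mathcomp Require Import boolp reals.
From mathcomp Require Import fingroup perm zify ring lra.
From mathcomp Require classical_sets filter topology normedtype.

(* Write r for the number of red points and r = c n + q with q < n; the islands
   will contain c or c + 1 red points.  Call a subset of X cut off by a line a
   halfplane of X.  If for some 0 < m < n a halfplane of k m points has exactly
   c m + p red points, for an admissible p, split there and induct.  Otherwise
   rotating the line shows that all halfplanes of k m points err on the same side
   of c m + p.  A discrete intermediate value argument on m then gives three
   groups (of 1, i and n - i - 1 islands) whose halfplanes all err on the same
   side, say have too few red points, and X must be cut into three convex pieces
   with the exact sizes and exact red counts of these groups.

   For directions u_0, u_1, u_2 the partitions W of X into three parts of
   prescribed sizes that maximize sum_z <u_(W z), z> have pairwise separated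
   parts.  Let u range over a two-parameter family in which, on the boundary, some
   part is a halfplane, hence short of red points.  Labelling a parameter by a part
   that is short of red points, Sperner's lemma and compactness give a parameter
   with three optimal partitions, the i-th one short of red points in part i.  By
   duality all optimal partitions are governed by the same prices; in general
   position few points are tied between two parts, and distributing the tied red
   points and the tied blue points independently gives an exact partition. *)

Set Implicit Arguments.
Unset Strict Implicit.
Unset Printing Implicit Defensive.

Import Order.TTheory GRing.Theory Num.Theory.

Lemma ord3_ind (P : 'I_3 -> Prop) :
  P ord0 -> P (Ordinal (isT : 1 < 3)%N) -> P (Ordinal (isT : 2 < 3)%N) ->
  forall i, P i.
Proof.
move=> p0 p1 p2 [[|[|[|//]]] lt3].
- by rewrite (_ : Ordinal lt3 = ord0) //; apply: val_inj.
- by rewrite (_ : Ordinal lt3 = Ordinal (isT : 1 < 3)%N) //; apply: val_inj.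
- by rewrite (_ : Ordinal lt3 = Ordinal (isT : 2 < 3)%N) //; apply: val_inj.
Qed.

(** * Sperner's lemma on a grid *)

Section Sperner.
Variable lab : nat -> nat -> 'I_3.

Let e (a b c d : nat) : bool :=
  [&& lab a b != ord0, lab c d != ord0 & lab a b != lab c d].

(** The relation [e] marks the edges that join labels 1 and 2. A square that misses a label has an
    even number of marked edges on its boundary; so without a full square all rows have the same
    parity of marked edges, while the top row has none. *)
Lemma sperner (P Q : nat) :
  (forall b, (b <= Q)%N -> lab 0 b = ord0 /\ lab P b = ord0) ->
  (forall a, (a <= P)%N -> lab a Q = ord0) ->
  odd (\sum_(0 <= a < P) e a 0 a.+1 0) ->
  exists a b, [/\ (a < P)%N, (b < Q)%N & forall i : 'I_3,
    exists da db : bool, lab (da + a) (db + b) = i].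
Proof.
move=> side top bot; apply: contrapT => none.
pose h b p := odd (\sum_(0 <= a < p) e a b a.+1 b).
have step b p : (b < Q)%N -> (p <= P)%N ->
    h b p (+) h b.+1 p = e p b p b.+1.
  move=> bQ; elim: p => [|p IH] pP.
    by rewrite /h !big_geq //= /e (side b (ltnW bQ)).1 eqxx.
  rewrite /h !big_nat_recr //= !oddD !oddb.
  have {}IH := IH (ltnW pP); rewrite /h in IH.
  rewrite addbACA IH.
  (* An odd number of marked edges around the square forces all three labels. This is checked on all
     labellings of the four corners. *)
  apply: contrapT => bad; apply: none; exists p, b; split=> // m.
  have E : m \in [:: lab p b; lab p.+1 b; lab p b.+1; lab p.+1 b.+1] ->
      exists da db : bool, lab (da + p) (db + b) = m.
    rewrite !inE => /or4P[] /eqP ->.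
    - by exists false, false.
    - by exists true, false.
    - by exists false, true.
    - by exists true, true.
  move: bad E; rewrite /e.
  move: (lab p b) (lab p.+1 b) (lab p b.+1) (lab p.+1 b.+1).
  clear => i j k l bad E; apply: E; rewrite !inE; move: bad.
  rewrite -!val_eqE /=.
  case: i j k l m => [[|[|[|//]]] ?] [[|[|[|//]]] ?] [[|[|[|//]]] ?]
    [[|[|[|//]]] ?] [[|[|[|//]]] ?] //=; by case.
have hQ d : forall c, (c + d = Q)%N -> h c P = h Q P.
  elim: d => [|d IH] c cQ; first by rewrite -cQ addn0.
  rewrite -(IH c.+1) ?addSnnS //.
  have cQ' : (c < Q)%N by rewrite -cQ addnS ltnS leq_addr.
  have := step c P cQ' (leqnn _).
  by rewrite /e (side c (ltnW cQ')).2 eqxx; case: (h c P); case: (h c.+1 P).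
have := hQ Q 0 (add0n _); rewrite {1}/h bot /h big_nat big1 //.
by move=> a /andP[_ aP]; rewrite /e top ?eqxx // ltnW.
Qed.
End Sperner.

(** * Assigning points to three parts *)

Section ThreeBins.
Variable T : finType.
Implicit Types (A B : {set T}) (W : {ffun T -> 'I_3}) (i j l : 'I_3).

Lemma ord3_third i j : i != j -> exists l, [/\ l != i, l != j,
  forall m, [|| m == i, m == j | m == l] &
  forall F : 'I_3 -> nat, \sum_m F m = (F i + F j + F l)%N].
Proof.
have E (F : 'I_3 -> nat) : \sum_m F m =
    (F ord0 + F (lift ord0 ord0) + F ord_max)%N.
  rewrite !big_ord_recl big_ord0 addn0 addnA; congr (_ + F _)%N.
  exact: val_inj.
have [m0 [m1 m2]] : ord0 = inord 0 :> 'I_3 /\ lift ord0 ord0 = inord 1 :> 'I_3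
   /\ ord_max = inord 2 :> 'I_3 by do !split; apply: val_inj; rewrite /= inordK.
have all m : [|| m == ord0, m == lift ord0 ord0 | m == ord_max :> 'I_3].
  by case: m => [[|[|[|//]]] ?].
have := all i; have := all j.
move=> /or3P[] /eqP-> /or3P[] /eqP-> // _;
  [exists ord_max|exists (lift ord0 ord0)|exists ord_max|exists ord0|exists (lift ord0 ord0)|exists ord0];
  split=> // [m|F]; rewrite ?E; try lia; have := all m;
  by do 3![case: (m == _)].
Qed.

Lemma ord3_other i : exists j, i != j.
Proof. by exists (if i == ord0 then ord_max else ord0); case: (i =P ord0) => [->|/eqP]. Qed.

Definition cnt B W i := #|[set z in B | W z == i]|.

Lemma sum_cnt B W : \sum_i cnt B W i = #|B|.
Proof.
rewrite /cnt -sum1_card (partition_big W predT) //=; apply: eq_bigr => i _.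
by rewrite -sum1_card; apply: eq_bigl => z; rewrite inE.
Qed.

Lemma cntE B W i : cnt B W i = \sum_(z in B) (W z == i).
Proof.
rewrite /cnt -sum1_card big_mkcond [RHS]big_mkcond /=; apply: eq_bigr => z _.
by rewrite inE; case: (z \in B); case: (W z == i).
Qed.

Definition reassign W x i : {ffun T -> 'I_3} := [ffun z => if z == x then i else W z].

Lemma cnt_reassign B W x i j : x \in B ->
  (cnt B (reassign W x i) j + (W x == j) =
   cnt B W j + (i == j))%N.
Proof.
move=> xB; rewrite !cntE (bigD1 x) //= [in RHS](bigD1 x) //= ffunE eqxx.
have -> : (\sum_(z in B | z != x) (reassign W x i z == j) =
  \sum_(z in B | z != x) (W z == j))%N.
  by apply: eq_bigr => z /andP[_ /negbTE zx]; rewrite ffunE zx.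
lia.
Qed.

Variable tau : T -> {set 'I_3}.

Definition compat A W := [forall z in A, W z \in tau z].

(** Hall's condition for three bins: the bound for a pair of bins is equivalent to one on the third
    bin, so conditions on single bins suffice. An assignment of least total deficit [D] is exact,
    since otherwise moving one or two points would lower [D]. *)
Lemma three_bins A (rho : 'I_3 -> nat) :
  (forall z, z \in A -> tau z != set0) ->
  (\sum_i rho i)%N = #|A| ->
  (forall i, (#|[set z in A | tau z == [set i]]| <= rho i)%N) ->
  (forall i, (rho i <= #|[set z in A | i \in tau z]|)%N) ->
  exists2 W, compat A W & forall i, cnt A W i = rho i.
Proof.
move=> tau0 rhoA forced able.
pose W0 : {ffun T -> 'I_3} := [ffun z => odflt ord0 [pick i in tau z]].
have cW0 : compat A W0.
  apply/forall_inP => z /tau0 /set0Pn[i iz]; rewrite ffunE; case: pickP => //=.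
  by move=> /(_ i); rewrite iz.
pose D W := (\sum_i (rho i - cnt A W i))%N.
have [W cW minW] : exists2 W, compat A W & forall V, compat A V -> (D W <= D V)%N.
  by have [W cW minW] := arg_minnP D cW0; exists W.
exists W => //; apply: contrapT => neq.
have [i lti] : exists i, (cnt A W i < rho i)%N.
  apply: contrapT => H; apply: neq => i.
  have le j : (rho j <= cnt A W j)%N.
    by rewrite leqNgt; apply/negP => ltj; apply: H; exists j.
  have [j ij] := ord3_other i; have [l [_ _ _ Dl]] := ord3_third ij.
  have := sum_cnt A W; rewrite -rhoA !Dl.
  by have := le i; have := le j; have := le l; lia.
have no_gain (V : {ffun T -> 'I_3}) (k : 'I_3) : compat A V -> i != k -> (rho k < cnt A W k)%N ->
    cnt A V i = (cnt A W i).+1 -> (cnt A V k).+1 = cnt A W k ->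
    (forall m, m != i -> m != k -> cnt A V m = cnt A W m) -> False.
  move=> cV ik ltk Vi Vk Vl; have [l [li lk _ Dl]] := ord3_third ik.
  have := minW V cV; rewrite /D !Dl (Vl l li lk).
  move: lti ltk Vi Vk; clear; lia.
have [x /andP[/andP[xA xi] Wx]] : exists x, (x \in A) && (i \in tau x) && (W x != i).
  apply/existsP/contraT => /existsPn H; move: lti; rewrite ltnNge.
  suff -> : (rho i <= cnt A W i)%N by [].
  apply: leq_trans (able i) _; apply: subset_leq_card; apply/subsetP => z.
  by rewrite !inE => /andP[zA zi]; have := H z; rewrite zA zi negbK.
have cset V z m : compat A V -> m \in tau z -> compat A (reassign V z m).
  move=> /forall_inP cV mz; apply/forall_inP => y yA; rewrite ffunE.
  by case: eqP => [->|_] //; exact: cV.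
have putE (V : {ffun T -> 'I_3}) y (k : 'I_3) : y \in A -> V y = k -> i != k ->
    [/\ cnt A (reassign V y i) i = (cnt A V i).+1, (cnt A (reassign V y i) k).+1 = cnt A V k &
    forall m, m != i -> m != k -> cnt A (reassign V y i) m = cnt A V m].
  move=> yA yk ik; have H m := cnt_reassign V i m yA; rewrite yk in H.
  split=> [||m mi mk].
  - by have := H i; rewrite eqxx eq_sym (negbTE ik); clear; lia.
  - by have := H k; rewrite eqxx (negbTE ik); clear; lia.
  - by have := H m; rewrite ![_ == m]eq_sym (negbTE mi) (negbTE mk); clear; lia.
set j := W x in Wx; rewrite eq_sym in Wx.
have [Vi Vj Vm] := putE W x j xA erefl Wx.
have [l [li lj ijl Dl]] := ord3_third Wx.
have [ltj|gej] := ltnP (rho j) (cnt A W j).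
  by have := no_gain _ j (cset _ _ _ cW xi) Wx ltj Vi Vj Vm.
(* Bin [j] has no point to spare, so the third bin [l] is overfull. A point [y] that may leave [l]
   goes either directly to [i], or to [j] while [x] goes from [j] to [i]. *)
have gtl : (rho l < cnt A W l)%N.
  have := sum_cnt A W; rewrite -rhoA !Dl; move: gej lti; clear; lia.
have [y /andP[/andP[yA /eqP yl] yt]] :
    exists y, (y \in A) && (W y == l) && (tau y != [set l]).
  apply/existsP/contraT => /existsPn H; move: gtl; rewrite ltnNge.
  suff -> : (cnt A W l <= rho l)%N by [].
  apply: leq_trans (forced l); apply: subset_leq_card; apply/subsetP => z.
  by rewrite !inE => /andP[zA zi]; have := H z; rewrite zA zi negbK.
have [m my ml] : exists2 m, m \in tau y & m != l.
  have lty : l \in tau y by move/forall_inP: cW => /(_ y yA); rewrite yl.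
  apply: contrapT => H; move: yt => /eqP; apply; apply/setP => m; rewrite inE.
  apply/idP/eqP => [my|->//]; apply: contrapT => /eqP ml; apply: H; exists m => //.
have il : i != l by rewrite eq_sym.
have := ijl m; rewrite (negbTE ml) orbF => /orP[] /eqP em; subst m.
  have [] := putE W y l yA yl il.
  exact: no_gain (cset _ _ _ cW my) il gtl.
set V := reassign W y j.
have H m := cnt_reassign W j m yA; rewrite yl -/V in H.
have Vx : V x = j by rewrite ffunE; case: eqP.
have [Ui Uj Um] := putE V x j xA Vx Wx.
have cU := cset _ _ _ (cset _ _ _ cW my) xi.
apply: (no_gain _ l cU il gtl).
- by rewrite Ui; have := H i; rewrite ![_ == i]eq_sym (negbTE il) (negbTE Wx); clear; lia.
- by rewrite Um //; have := H l; rewrite eqxx eq_sym (negbTE lj); clear; lia.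
- move=> m mi ml'; have := ijl m; rewrite (negbTE mi) (negbTE ml') orbF /= => /eqP ->.
  by move: (H j) Uj; rewrite eqxx (negbTE lj) -/V; clear; lia.
Qed.

(* [tau z] is the set of parts that [z] may be assigned to.  If all three given
   assignments were short of red points ([B]) in part [i], two of them would
   differ by three red and three blue points in another part, and these are all
   tied: too many. *)
Lemma exact_selection A B (N x : 'I_3 -> nat) :
  (forall i j, i != j -> (#|[set z in A | (i \in tau z) && (j \in tau z)]| <= 2)%N) ->
  (forall i, (x i <= N i)%N) ->
  (\sum_i x i)%N = #|A :&: B| ->
  (forall i, exists W, [/\ compat A W, forall j, cnt A W j = N j &
     (cnt (A :&: B) W i < x i)%N]) ->
  exists W, [/\ compat A W, forall j, cnt A W j = N j &
     forall j, cnt (A :&: B) W j = x j].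
Proof.
move=> tie xN xB ex.
have cntD W i : cnt A W i = (cnt (A :&: B) W i + cnt (A :\: B) W i)%N.
  rewrite !cntE (bigID [in B]) /=; congr (_ + _)%N; apply: eq_bigl => z;
    by rewrite !inE ?[_ && (z \in A)]andbC.
have compatS W A' : A' \subset A -> compat A W -> compat A' W.
  by move=> /subsetP s /forall_inP cW; apply/forall_inP => z /s; apply: cW.
have SI : A :&: B \subset A by apply: subsetIl.
have SD : A :\: B \subset A by apply: subsetDl.
have lo W A' i : compat A' W -> (#|[set z in A' | tau z == [set i]]| <= cnt A' W i)%N.
  move=> /forall_inP cW; apply: subset_leq_card; apply/subsetP => z.
  rewrite !inE => /andP[zA /eqP ez]; rewrite zA /=.
  by have := cW z zA; rewrite ez inE.
have hi W A' i : compat A' W -> (cnt A' W i <= #|[set z in A' | i \in tau z]|)%N.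
  move=> /forall_inP cW; apply: subset_leq_card; apply/subsetP => z.
  rewrite !inE => /andP[zA /eqP <-]; rewrite zA /=; exact: cW.
have big i : exists W, [/\ compat A W, forall j, cnt A W j = N j &
     (x i <= cnt (A :&: B) W i)%N].
  apply: contrapT => none.
  have lt W : compat A W -> (forall j, cnt A W j = N j) -> (cnt (A :&: B) W i < x i)%N.
    by move=> cW sW; rewrite ltnNge; apply/negP => le; apply: none; exists W.
  have [j ij] := ord3_other i.
  have [l [li lj ijl Dl]] := ord3_third ij.
  have [U [cU sU Uj]] := ex j; have [V [cV sV Vl]] := ex l.
  have Ui := lt _ cU sU.
  (* [U] is short of red points in both [i] and [j], so it has an excess of at least two in [l],
     where [V] is short by at least one: a gap of three. *)
  have Ul : (x l + 2 <= cnt (A :&: B) U l)%N.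
    by have := sum_cnt (A :&: B) U; rewrite -xB !Dl; lia.
  pose P W A' := [set z in A' | W z == l].
  have dR : (3 <= #|P U (A :&: B) :\: P V (A :&: B)|)%N.
    have := cardsID (P V (A :&: B)) (P U (A :&: B)).
    have := subset_leq_card (subsetIr (P U (A :&: B)) (P V (A :&: B))).
    by move: Ul Vl; rewrite /cnt /P; lia.
  have dB : (3 <= #|P V (A :\: B) :\: P U (A :\: B)|)%N.
    have := cardsID (P U (A :\: B)) (P V (A :\: B)).
    have := subset_leq_card (subsetIr (P V (A :\: B)) (P U (A :\: B))).
    have := cntD U l; have := cntD V l; rewrite sU sV.
    by move: Ul Vl; rewrite /cnt /P; lia.
  have := tie l i li; have := tie l j lj.
  set Ti := [set z in A | _]; set Tj := [set z in A | _] => ti tj.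
  have : (#|(P U (A :&: B) :\: P V (A :&: B)) :|: (P V (A :\: B) :\: P U (A :\: B))| <= #|Ti :|: Tj|)%N.
    apply: subset_leq_card; apply/subsetP => z.
    move/forall_inP: cU => /(_ z); move/forall_inP: cV => /(_ z).
    rewrite !inE; case zA: (z \in A); case zB: (z \in B) => //= /(_ isT) tV /(_ isT) tU;
      rewrite ?orbF ?andbT /= => /andP[/negP neq /eqP eq].
      rewrite -eq tU /=; have := ijl (V z).
      by move: tV neq; move: (V z) => m + + /or3P[] /eqP em; rewrite em ?eqxx // => ->; rewrite ?orbT.
    rewrite -eq tV /=; have := ijl (U z).
    by move: tU neq; move: (U z) => m + + /or3P[] /eqP em; rewrite em ?eqxx // => ->; rewrite ?orbT.
  have I0 : (P U (A :&: B) :\: P V (A :&: B)) :&: (P V (A :\: B) :\: P U (A :\: B)) = set0.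
    by apply/setP => z; rewrite /P !inE; case: (z \in B); rewrite /= ?andbF ?andbT.
  rewrite cardsU I0 cards0.
  move: (leq_card_setU Ti Tj).1 ti tj dR dB; clear; lia.
have [WR cR sR] : exists2 W, compat (A :&: B) W & forall i, cnt (A :&: B) W i = x i.
  have [W [cW _ _]] := ex ord0.
  apply: three_bins => //.
  - move=> z zA; apply/set0Pn; exists (W z).
    by move/forall_inP: cW; apply; apply: (subsetP SI).
  - move=> i; have [U [cU _ Ui]] := ex i.
    by apply: leq_trans (ltnW Ui); apply/lo/(compatS _ _ SI).
  - move=> i; have [U [cU _ Ui]] := big i.
    by apply: leq_trans Ui _; apply/hi/(compatS _ _ SI).
(* For the blue points the two bounds trade witnesses: since sizes are fixed, an assignment with
   many red points in part [i] has few blue ones there, and conversely. *)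
have [WB cB sB] : exists2 W, compat (A :\: B) W & forall i, cnt (A :\: B) W i = (N i - x i)%N.
  have [W [cW sW _]] := ex ord0.
  apply: three_bins => //.
  - move=> z zA; apply/set0Pn; exists (W z).
    by move/forall_inP: cW; apply; apply: (subsetP SD).
  - have := sum_cnt A W; have := cardsID B A; rewrite -xB.
    have [l [_ _ _ Dl]] := @ord3_third ord0 ord_max isT; rewrite !Dl !sW.
    have := xN ord0; have := xN l; have := xN ord_max; lia.
  - move=> i; have [U [cU sU Ui]] := big i.
    have := lo U (A :\: B) i (compatS _ _ SD cU); have := cntD U i; rewrite sU.
    by move: Ui; lia.
  - move=> i; have [U [cU sU Ui]] := ex i.
    have := hi U (A :\: B) i (compatS _ _ SD cU); have := cntD U i; rewrite sU.
    by move: Ui; lia.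
pose W : {ffun T -> 'I_3} := [ffun z => if z \in B then WR z else WB z].
have WRE i : cnt (A :&: B) W i = x i.
  rewrite -sR; apply: eq_card => z; rewrite !inE ffunE.
  by case: (z \in B); rewrite ?andbF.
have WBE i : cnt (A :\: B) W i = (N i - x i)%N.
  rewrite -sB; apply: eq_card => z; rewrite !inE ffunE.
  by case: (z \in B); rewrite ?andbF.
exists W; split=> //.
- apply/forall_inP => z zA; rewrite ffunE; case: ifPn => zB.
    by move/forall_inP: cR; apply; rewrite inE zA.
  by move/forall_inP: cB; apply; rewrite inE zA zB.
- by move=> j; rewrite cntD WRE WBE subnKC.
Qed.

End ThreeBins.

(** * Optimal assignments and dual prices *)

Section Optimal.
Local Open Scope ring_scope.
Variables (R : realType) (T : finType) (A : {set T}) (N : 'I_3 -> nat).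
Implicit Types (a : 'I_3 -> T -> R) (W V : {ffun T -> 'I_3}) (i j l : 'I_3).

Definition sized W := [forall i, cnt A W i == N i].
Definition gain a W := \sum_(z in A) a (W z) z.
Definition optimal a W :=
  sized W && [forall V : {ffun T -> 'I_3}, sized V ==> (gain a V <= gain a W)].

Lemma optimal_exists a : (\sum_i N i)%N = #|A| -> exists W, optimal a W.
Proof.
move=> sN.
have t0 z : z \in A -> [set: 'I_3] != set0 by move=> _; apply/set0Pn; exists ord0.
have [i|i|W _ sW] := three_bins t0 sN.
- rewrite (_ : [set z in A | _] = set0) ?cards0 //.
  apply/setP => z; rewrite !inE; apply/negbTE/nandP; right.
  by apply/eqP => /(congr1 (fun s : {set 'I_3} => #|s|)); rewrite cardsT card_ord cards1.
- rewrite (_ : [set z in A | _] = A) -?sN.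
    by rewrite (bigD1 i) //= leq_addr.
  by apply/setP => z; rewrite !inE andbT.
have sW' : sized W by apply/forallP => i; apply/eqP.
case: (arg_maxP (gain a) sW') => V sV maxV; exists V.
by rewrite /optimal sV; apply/forallP => U; apply/implyP => /maxV.
Qed.

Lemma optimal_perm a W (s : {perm T}) : optimal a W -> perm_on A s ->
  \sum_(z in A) a (W z) (s z) <= \sum_(z in A) a (W z) z.
Proof.
move=> /andP[/forallP sW /forallP mW] sA.
pose V : {ffun T -> 'I_3} := [ffun z => W (s^-1%g z)].
have <- : gain a V = \sum_(z in A) a (W z) (s z).
  rewrite /gain (reindex_inj (@perm_inj _ s)) /=; apply: eq_big => z.
    exact: perm_closed.
  by rewrite ffunE permK.
apply: (implyP (mW V)); apply/forallP => i; rewrite -(eqP (sW i)) !cntE.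
rewrite (reindex_inj (@perm_inj _ s)) /=; apply/eqP/eq_big => z.
  exact: perm_closed.
by rewrite ffunE permK.
Qed.

Lemma optimal_swap a W x y : optimal a W -> x \in A -> y \in A ->
  a (W x) y + a (W y) x <= a (W x) x + a (W y) y.
Proof.
move=> oW xA yA; have [->|xy] := eqVneq x y; first exact: lexx.
have sA : perm_on A (tperm x y).
  apply/subsetP => z; rewrite inE; case: tpermP => [->|->|_ _] //.
  by rewrite eqxx.
have := optimal_perm oW sA.
have yA' : (y \in A) && (y != x) by rewrite yA eq_sym.
rewrite !(bigD1 x xA) !(bigD1 y yA') /= tpermL tpermR.
rewrite (eq_bigr (fun z => a (W z) z)); first by lra.
by move=> z /andP[/andP[_ zx] zy]; rewrite tpermD // eq_sym.
Qed.

Lemma optimal_cycle a W x y z : optimal a W -> x \in A -> y \in A -> z \in A ->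
  uniq [:: x; y; z] ->
  a (W x) y + a (W y) z + a (W z) x <= a (W x) x + a (W y) y + a (W z) z.
Proof.
move=> oW xA yA zA; rewrite /= !inE negb_or andbT => /andP[/andP[xy xz] yz].
pose s := (tperm x y * tperm x z)%g.
have sx : s x = y by rewrite permM tpermL tpermD // eq_sym.
have sy : s y = z by rewrite permM tpermR tpermL.
have sz : s z = x by rewrite permM [tperm x y z]tpermD ?tpermR.
have sD t : t != x -> t != y -> t != z -> s t = t.
  by move=> tx ty tz; rewrite permM !tpermD // eq_sym.
have sA : perm_on A s.
  apply/subsetP => t; rewrite inE; apply: contraR => tA.
  by rewrite sD //; apply: contraNneq tA => ->.
have := optimal_perm oW sA.
have yA' : (y \in A) && (y != x) by rewrite yA eq_sym.
have zA' : (z \in A) && (z != x) && (z != y) by rewrite zA ![z == _]eq_sym xz yz.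
rewrite !(bigD1 x xA) !(bigD1 y yA') /= !(bigD1 z zA') /= sx sy sz.
rewrite (eq_bigr (fun t => a (W t) t)); first by lra.
by move=> t /andP[/andP[/andP[_ tx] ty] tz]; rewrite sD.
Qed.

(** A weighted digraph on three vertices without negative cycles has a potential. The witnesses are
    the shortest distances from vertex 0. *)
Lemma potentials (d01 d02 d10 d12 d20 d21 : R) :
  0 <= d01 + d10 -> 0 <= d02 + d20 -> 0 <= d12 + d21 ->
  0 <= d01 + d12 + d20 -> 0 <= d02 + d21 + d10 ->
  exists c0 c1 c2 : R, [/\ c1 - c0 <= d01, c2 - c0 <= d02, c0 - c1 <= d10,
     c2 - c1 <= d12 & (c0 - c2 <= d20) /\ (c1 - c2 <= d21)].
Proof.
move=> h1 h2 h3 h4 h5; exists 0, (Num.min d01 (d02 + d21)), (Num.min d02 (d01 + d12)).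
by have [?|?] := leP d01 (d02 + d21); have [?|?] := leP d02 (d01 + d12);
  split; try split; lra.
Qed.

(* [c] is a dual optimal solution of the assignment problem with value [a]. *)
Definition priced a (c : 'I_3 -> R) W :=
  forall z j, z \in A -> a j z + c j <= a (W z) z + c (W z).

(** Give the arc from [i] to [j] the least loss of moving a point from part [i] to part [j]. A
    negative cycle would be a profitable exchange of points, so the graph has a potential, and this
    is the price vector. *)
Lemma optimal_priced a W : (forall i, 0 < N i)%N -> optimal a W ->
  exists c, priced a c W.
Proof.
move=> N0 oW; have /andP[/forallP sW _] := oW.
(* [x] is the cheapest point to move from part [i] to part [j]. *)
have cheap i j : exists2 x, (x \in A) && (W x == i) &
    forall z, z \in A -> W z = i -> a i x - a j x <= a i z - a j z.
  have /card_gt0P[x0] : (0 < cnt A W i)%N by rewrite (eqP (sW i)).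
  rewrite inE => x0P.
  case: (@arg_minP _ _ _ x0 (fun x => (x \in A) && (W x == i))
    (fun z => a i z - a j z) x0P) => x xP minx; exists x => //.
  by move=> z zA /eqP Wz; apply: minx; rewrite zA.
pose i0 : 'I_3 := ord0; pose i1 := Ordinal (isT : 1 < 3)%N.
pose i2 := Ordinal (isT : 2 < 3)%N.
have n01 : i0 != i1 by [].
have n02 : i0 != i2 by [].
have n12 : i1 != i2 by [].
have two i j x y : i != j -> (x \in A) && (W x == i) -> (y \in A) && (W y == j) ->
    0 <= (a i x - a j x) + (a j y - a i y).
  move=> ij /andP[xA /eqP Wx] /andP[yA /eqP Wy].
  by have := optimal_swap oW xA yA; rewrite Wx Wy; lra.
have three i j l x y z : uniq [:: i; j; l] -> (x \in A) && (W x == i) ->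
    (y \in A) && (W y == j) -> (z \in A) && (W z == l) ->
    0 <= (a i x - a j x) + (a j y - a l y) + (a l z - a i z).
  move=> ijl /andP[xA /eqP Wx] /andP[yA /eqP Wy] /andP[zA /eqP Wz].
  have xyz : uniq [:: x; z; y].
    rewrite -(map_inj_in_uniq (f := W)) /= ?Wx ?Wy ?Wz.
      by move: ijl; rewrite /= !inE !negb_or; case/andP => /andP[-> ->]; rewrite eq_sym => ->.
    move=> s t; rewrite !inE => /or3P[] /eqP-> /or3P[] /eqP->; rewrite ?Wx ?Wy ?Wz //;
      by move: ijl; rewrite /= !inE !negb_or andbT => /andP[/andP[ij il] jl] e; move: ij il jl; rewrite e eqxx.
  (* The order is [x], [z], [y] because in [optimal_cycle] the part of each point receives the next
     point; thus [x] moves to [j], [y] to [l] and [z] to [i]. *)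
  have := optimal_cycle oW xA zA yA xyz; rewrite Wx Wy Wz; lra.
have [x01 h01 m01] := cheap i0 i1; have [x02 h02 m02] := cheap i0 i2.
have [x10 h10 m10] := cheap i1 i0; have [x12 h12 m12] := cheap i1 i2.
have [x20 h20 m20] := cheap i2 i0; have [x21 h21 m21] := cheap i2 i1.
have [||||c0 [c1 [c2 [k01 k02 k10 k12 [k20 k21]]]]] :=
  @potentials (a i0 x01 - a i1 x01) (a i0 x02 - a i2 x02) (a i1 x10 - a i0 x10)
    (a i1 x12 - a i2 x12) (a i2 x20 - a i0 x20) (a i2 x21 - a i1 x21)
    (two _ _ _ _ n01 h01 h10).
- exact: two.
- exact: two.
- by apply: three => //; rewrite /= !inE negb_or n01 n02 n12.
- by apply: three => //; rewrite /= !inE negb_or n02 n01 eq_sym n12.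
exists (fun i => if i == i0 then c0 else if i == i1 then c1 else c2).
move=> z j zA; have : W z = W z by [].
move: {-1}(W z) => i; elim/ord3_ind: i; elim/ord3_ind: j => Wz;
  rewrite ?eqxx ?(eq_sym i1 i0) ?(eq_sym i2 i0) ?(eq_sym i2 i1) ?(negbTE n01) ?(negbTE n02) ?(negbTE n12) //.
- by have := m01 z zA Wz; lra.
- by have := m02 z zA Wz; lra.
- by have := m10 z zA Wz; lra.
- by have := m12 z zA Wz; lra.
- by have := m20 z zA Wz; lra.
- by have := m21 z zA Wz; lra.
Qed.

(** Complementary slackness: prices add the same constant to the gain of every sized assignment.
    Since [W] maximizes the priced value at each point and [V] has the same total, [V] attains the
    maximum at each point too. *)
Lemma optimal_price_shared a c W V : optimal a W -> optimal a V ->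
  priced a c W -> priced a c V.
Proof.
move=> /andP[sW mW] /andP[sV mV] cW z j zA.
have gainc U : sized U -> \sum_(t in A) (a (U t) t + c (U t)) =
    gain a U + \sum_i c i *+ N i.
  move=> /forallP sU; rewrite big_split /=; congr (_ + _).
  rewrite (partition_big U predT) //=; apply: eq_bigr => i _.
  rewrite -(eqP (sU i)) -sumr_const; apply: eq_big => [t|t /andP[_ /eqP->] //].
  by rewrite inE.
have : gain a V = gain a W.
  apply: le_anti; rewrite (implyP (forallP mW V)) //.
  by rewrite (implyP (forallP mV W)).
move/(congr1 (fun r => r + \sum_i c i *+ N i)); rewrite -!gainc // => e.
have d0 t : t \in A -> 0 <= a (W t) t + c (W t) - (a (V t) t + c (V t)).
  by move=> tA; rewrite subr_ge0 cW.
have /eqP : \sum_(t in A) (a (W t) t + c (W t) - (a (V t) t + c (V t))) = 0.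
  by rewrite sumrB e subrr.
rewrite psumr_eq0 // => /allP /(_ z); rewrite mem_index_enum zA => /(_ isT) /implyP /(_ isT).
by rewrite subr_eq0 => /eqP <-; apply: cW.
Qed.

End Optimal.

(** * Halfplanes *)

Section Halfplanes.
Local Open Scope ring_scope.
Variables (R : realType) (T : finType) (px py : T -> R).
Implicit Types (d : R * R) (A B H : {set T}).

Definition dot d (z : T) := d.1 * px z + d.2 * py z.

(** The inequality is weak, so points on the boundary line may fall on either side. Hence every size
    occurs in every direction, but the halfplane need not be unique. *)
Definition halfplane d A H :=
  H \subset A /\ forall y z, y \in H -> z \in A :\: H -> dot d z <= dot d y.

Lemma halfplane_exists d A n : (n <= #|A|)%N ->
  exists2 H, halfplane d A H & #|H| = n.
Proof.
elim: n => [|n IH] nA.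
  exists set0; last exact: cards0.
  by split; [apply: sub0set|move=> y z; rewrite inE].
have [H [HA sepH] cH] := IH (ltnW nA).
have [x0 x0P] : exists x0, x0 \in A :\: H.
  by apply/set0Pn; rewrite -card_gt0 cardsD (setIidPr HA) cH subn_gt0.
case: (@arg_maxP _ _ _ x0 (mem (A :\: H)) (dot d) x0P) => x /= xP maxx.
have [xH xA] := setDP xP; exists (x |: H); last by rewrite cardsU1 xA cH.
split; first by rewrite subUset sub1set xH.
move=> y z yH; rewrite !inE negb_or => /andP[/andP[zx zH] zA].
move: yH; rewrite !inE => /orP[/eqP->|yH]; first by apply: maxx; apply/setDP.
by apply: sepH => //; rewrite !inE zH.
Qed.

Lemma halfplane_compl d A H : halfplane d A H ->
  halfplane (- d.1, - d.2) A (A :\: H).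
Proof.
move=> [HA sepH]; split; first exact: subsetDl.
move=> y z yH; rewrite setDDr setDv set0U inE => /andP[zA zH].
by have := sepH z y zH yH; rewrite /dot /=; lra.
Qed.

Hypothesis no3 : forall d (r : R), d != (0, 0) ->
  (#|[set z | dot d z == r]| <= 2)%N.

(** All points in which [H] and [H'] differ lie on one common boundary line, and equal sizes make
    the two differences equally large. *)
Lemma halfplane_swap d A H H' : d != (0, 0) -> halfplane d A H ->
  halfplane d A H' -> #|H| = #|H'| -> (#|H :\: H'| <= 1)%N.
Proof.
move=> d0 [HA sH] [HA' sH'] eqH; rewrite leqNgt; apply/negP => lt1.
have eqD : #|H :\: H'| = #|H' :\: H|.
  by have := cardsID H H'; have := cardsID H' H; rewrite setIC; lia.
have /card_gt0P[y yP] : (0 < #|H' :\: H|)%N by rewrite -eqD; lia.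
have inD (H1 H2 : {set T}) z : H1 \subset A -> z \in H1 :\: H2 ->
    z \in H1 /\ z \in A :\: H2.
  by move=> /subsetP s; rewrite !inE => /andP[zH2 zH1]; rewrite zH1 zH2 s.
have eqv z : z \in H :\: H' -> dot d z = dot d y.
  move=> zP; have [zH zA] := inD _ _ _ HA zP; have [yH yA] := inD _ _ _ HA' yP.
  by apply: le_anti; apply/andP; split; [exact: sH'|exact: sH].
have : (#|(H :\: H') :|: [set y]| <= #|[set z | dot d z == dot d y]|)%N.
  apply: subset_leq_card; apply/subsetP => z; rewrite in_setU in_set1 inE.
  by case/orP => [/eqv->|/eqP->].
have yD : y \notin H :\: H' by move: yP; rewrite !inE => /andP[/negbTE->]; rewrite andbF.
rewrite setUC cardsU1 yD => le; have := leq_trans le (no3 _ d0); lia.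
Qed.

Lemma halfplane_close d A B H H' : d != (0, 0) -> halfplane d A H ->
  halfplane d A H' -> #|H| = #|H'| -> (#|H :&: B| <= #|H' :&: B|.+1)%N.
Proof.
move=> d0 hH hH' eqH; have := halfplane_swap d0 hH hH' eqH.
have sub : H :&: B \subset (H' :&: B) :|: (H :\: H').
  by apply/subsetP => z; rewrite !inE => /andP[-> ->]; case: (z \in H').
have := subset_leq_card sub; have := (leq_card_setU (H' :&: B) (H :\: H')).1.
lia.
Qed.

Section Separated.
Variables (A : {set T}) (N : 'I_3 -> nat) (u : 'I_3 -> R * R).
Let a i z := dot (u i) z.

(** Exchanging a point [y] of part [i] with a point [z] of another part changes the gain by a
    positive multiple of [dot d z - dot d y]. *)
Lemma optimal_halfplane W i d : optimal A N a W ->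
  (forall j, j != i -> exists2 m : R, 0 < m &
     u i = ((u j).1 + m * d.1, (u j).2 + m * d.2)) ->
  halfplane d A [set z in A | W z == i].
Proof.
move=> oW du; split; first by apply/subsetP => z; rewrite inE => /andP[].
move=> y z; rewrite !inE => /andP[yA /eqP Wy] /andP[/nandP[/negP//|Wz] zA].
have [m m0 e] := du _ Wz.
have := optimal_swap oW yA zA; rewrite Wy /a e /dot /= => h.
have : 0 <= m * ((d.1 * px y + d.2 * py y) - (d.1 * px z + d.2 * py z)) by lra.
by rewrite pmulr_rge0 // subr_ge0.
Qed.

(** Let [tau z] consist of the parts of maximal priced value at [z]. Points tied between [i] and [j]
    lie on a line with normal [u i - u j], so there are at most two. The same line weakly separates
    parts [i] and [j] of any assignment compatible with [tau]. *)
Lemma separated_exact (B : {set T}) (x : 'I_3 -> nat) :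
  (forall i j, i != j -> u i != u j) ->
  (forall i, 0 < N i)%N -> (forall i, x i <= N i)%N ->
  (\sum_i x i)%N = #|A :&: B| ->
  (forall i, exists2 W, optimal A N a W & (cnt (A :&: B) W i < x i)%N) ->
  exists W, [/\ sized A N W, forall i, cnt (A :&: B) W i = x i &
    forall i j, i != j -> exists2 d, d != (0, 0) &
      forall y z, y \in A -> z \in A -> W y = i -> W z = j -> dot d z <= dot d y].
Proof.
move=> u_inj N0 xN sx ex.
have [W0 oW0 _] := ex ord0; have [c cW0] := optimal_priced N0 oW0.
pose tau z := [set i | [forall j, a j z + c j <= a i z + c i]].
have inP z i j : i \in tau z -> a j z + c j <= a i z + c i.
  by rewrite inE => /forallP.
have compatP W : optimal A N a W -> compat tau A W.
  move=> oW; apply/forall_inP => z zA; rewrite inE; apply/forallP => j.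
  exact: (optimal_price_shared oW0 oW cW0).
have [||W [cW sW xW]] := @exact_selection _ tau A B N x _ xN sx.
- move=> i j ij.
  have dn0 : ((u i).1 - (u j).1, (u i).2 - (u j).2) != (0, 0).
    apply: contra (u_inj _ _ ij) => /eqP[/eqP]; rewrite subr_eq0 => /eqP e1 /eqP.
    by rewrite subr_eq0 => /eqP e2; apply/eqP; case: (u i) (u j) e1 e2 => ? ? [? ?] /= -> ->.
  apply: leq_trans (no3 (c j - c i) dn0); apply: subset_leq_card.
  apply/subsetP => z; rewrite inE => /andP[_ /andP[iz jz]]; rewrite inE.
  apply/eqP; have := inP z i j iz; have := inP z j i jz; rewrite /a /dot /=; lra.
- move=> i; have [W oW xW] := ex i; exists W; split => //; first exact: compatP.
  by case/andP: oW => /forallP sW _ j; apply/eqP.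
exists W; split=> // [|i j ij]; first by apply/forallP => i; apply/eqP.
exists ((u i).1 - (u j).1, (u i).2 - (u j).2).
  apply: contra (u_inj _ _ ij) => /eqP[/eqP]; rewrite subr_eq0 => /eqP e1 /eqP.
  by rewrite subr_eq0 => /eqP e2; apply/eqP; case: (u i) (u j) e1 e2 => ? ? [? ?] /= -> ->.
move=> y z yA zA Wy Wz; have /forall_inP cW' := cW.
have := inP y i j; rewrite -{1}Wy => /(_ (cW' _ yA)).
have := inP z j i; rewrite -{1}Wz => /(_ (cW' _ zA)).
rewrite /a /dot /=; lra.
Qed.

End Separated.
End Halfplanes.

(** * Compactness and connectedness *)

Section Topology.
Import classical_sets filter topology normedtype.
Import numFieldNormedType.Exports.
Local Open Scope ring_scope.
Local Open Scope classical_set_scope.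
Variable R : realType.

(** If no radius works, the sets of points bad for a given radius form a filter base. Around a
    cluster point [z] some ball lies in [U z], and it contains the half-size ball around a nearby
    bad point. *)
Lemma lebesgue_number (M : pseudoMetricType R) (K : set M) (U : M -> set M) :
  compact K -> (forall z, K z -> nbhs z (U z)) ->
  exists2 e : R, 0 < e & forall z, K z -> exists2 z0, K z0 & ball z e `<=` U z0.
Proof.
move=> cK nU; apply: contrapT => none.
pose bad (e : R) := [set z | K z /\ forall z0, K z0 -> ~ ball z e `<=` U z0].
have bad0 e : 0 < e -> bad e !=set0.
  move=> e0; apply: contrapT => nb; apply: none; exists e => // z Kz.
  apply: contrapT => nz; apply: nb; exists z; split=> // z0 Kz0 sub.
  by apply: nz; exists z0.
pose F := filter_from [set e : R | 0 < e] bad.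
have FF : ProperFilter F.
  apply: filter_from_proper => //; apply: filter_from_filter; first by exists 1 => /=.
  move=> d e /= d0 e0; exists (Num.min d e) => /=; first by rewrite lt_min d0.
  have le r s : r <= s -> bad r `<=` bad s.
    move=> rs z [Kz nz]; split=> // z0 /nz h sub; apply: h.
    exact: subset_trans (le_ball rs) sub.
  by move=> z bz; split; apply: le bz; rewrite ge_min lexx ?orbT.
have [z [Kz cz]] : K `&` cluster F !=set0.
  by apply: cK; exists 1 => //= z [].
have /nbhs_ballP[e /= e0 sub] := nU z Kz.
have e20 : 0 < e / 2 by rewrite divr_gt0.
have [y [[Ky ny] by_]] : bad (e / 2) `&` ball z (e / 2) !=set0.
  by apply: cz; [exists (e / 2)|apply: nbhsx_ballx].
apply: (ny z Kz) => x bx; apply: sub; rewrite [e]splitr.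
exact: ball_triangle by_ bx.
Qed.

(** A locally constant property holds on a relatively open and closed subset of the segment, which
    is connected. *)
Lemma segment_transfer (Q : R -> Prop) :
  (forall t : R, 0 <= t <= 1 -> \forall s \near t, 0 <= s <= 1 -> (Q s <-> Q t)) ->
  Q 0 -> Q 1.
Proof.
move=> loc Q0.
pose I := [set t : R | 0 <= t <= 1].
have cI : connected I.
  have -> : I = `[0, 1] by apply/seteqP; split=> t /=; rewrite in_itv.
  exact: segment_connected.
(* Points outside the segment satisfy the implication trivially, so the interior in the whole line
   serves as a relative interior. *)
pose C (P : R -> Prop) := ([set s | 0 <= s <= 1 -> P s])°.
have CP (P : R -> Prop) t : (forall t : R, 0 <= t <= 1 ->
    \forall s \near t, 0 <= s <= 1 -> (P s <-> P t)) -> I t -> C P t <-> P t.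
  move=> locP It; split => [/nbhs_singleton/(_ It) //|Pt].
  by apply: filterS (locP t It) => s /[swap] /[dup] Is /[swap] /[apply] ->.
have locN (t : R) : 0 <= t <= 1 -> \forall s \near t, 0 <= s <= 1 -> (~ Q s <-> ~ Q t).
  by move=> It; apply: filterS (loc t It) => s /[apply] ->.
have [I0 I1] : I 0 /\ I 1 by rewrite /I /= lexx ler01 lexx.
have : (I `&` C Q) 1; last by case=> _ /(CP _ _ loc I1).
rewrite (cI (I `&` C Q)) //.
- by exists 0; split=> //; apply/(CP _ _ loc).
- by exists (C Q) => //; apply: open_interior.
- exists (~` C (fun s => ~ Q s)); first exact/open_closedC/open_interior.
  apply/seteqP; split=> t [It Ct]; split=> //.
    by move=> /(CP _ _ locN It); apply; apply/(CP _ _ loc It).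
  apply/(CP _ _ loc It); apply: contrapT => nQ; apply: Ct.
  exact/(CP _ _ locN It).
Qed.

Lemma near_imply (M : topologicalType) (v : M) (P : Prop) (Q : M -> Prop) :
  (P -> nbhs v Q) -> nbhs v (fun v' => P -> Q v').
Proof.
have [p|np] := pselect P; last by move=> _; apply: nearW => v' /np.
by move=> /(_ p); apply: filterS => v' q.
Qed.

End Topology.

(** * All halfplanes of a size that avoids a red count err on the same side *)

Section Dichotomy.
Import classical_sets filter topology normedtype.
Import numFieldNormedType.Exports.
Local Open Scope classical_set_scope.
Local Open Scope ring_scope.
Variables (R : realType) (T : finType) (px py : T -> R).
Implicit Types (d : R * R) (A B H : {set T}).
Local Notation dot := (dot px py).
Local Notation halfplane := (halfplane px py).

(** If [H] is not a halfplane at [t], some pair of points violates the inequality strictly, and it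
    still does so nearby. There are finitely many [H]. *)
Lemma halfplane_near (M : topologicalType) (f g : M -> R) (t : M) A :
  {for t, continuous f} -> {for t, continuous g} ->
  \forall s \near t, forall H, halfplane (f s, g s) A H -> halfplane (f t, g t) A H.
Proof.
move=> cf cg; apply: filter_forall => H.
have [h|nh] := pselect (halfplane (f t, g t) A H); first exact: nearW.
have [HA|nHA] := boolP (H \subset A); last first.
  by apply: nearW => s [HA]; case/negP: nHA.
have [y [z [yH zH lt]]] : exists y z, [/\ y \in H, z \in A :\: H &
    dot (f t, g t) y < dot (f t, g t) z].
  apply: contrapT => none; apply: nh; split=> // y z yH zH.
  by rewrite leNgt; apply/negP => lt; apply: none; exists y, z.
have cp x : (fun s => dot (f s, g s) x) @ t --> dot (f t, g t) x.
  by apply: cvgD; apply: cvgM => //; apply: cvg_cst.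
have : \forall s \near t, 0 < dot (f s, g s) z - dot (f s, g s) y.
  have c : (fun s => dot (f s, g s) z - dot (f s, g s) y) @ t -->
      dot (f t, g t) z - dot (f t, g t) y by apply: cvgB; apply: cp.
  by apply: cvgr_gt c _ _; rewrite subr_gt0.
apply: filterS => s; rewrite subr_gt0 => lts [_ sep].
by have := sep y z yH zH; rewrite leNgt lts.
Qed.

Hypothesis no3 : forall d (r : R), d != (0, 0) ->
  (#|[set z | dot d z == r]%SET| <= 2)%N.

Variables (A B : {set T}) (n x : nat).
Hypothesis nA : (n <= #|A|)%N.
Hypothesis avoid : forall d H, d != (0, 0) -> halfplane d A H -> #|H| = n ->
  #|H :&: B| <> x.

Let low d := exists H, [/\ halfplane d A H, #|H| = n & (#|H :&: B| < x)%N].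

(** Red counts of halfplanes with the same direction and size differ by at most one, so they cannot
    lie on both sides of the avoided value [x]. *)
Let low_all d H : d != (0, 0) -> low d -> halfplane d A H -> #|H| = n ->
  (#|H :&: B| < x)%N.
Proof.
move=> d0 [H' [hH' cH' lt]] hH cH.
have := halfplane_close no3 B d0 hH hH'; rewrite cH cH' => /(_ erefl).
have := avoid d0 hH cH; lia.
Qed.

Let low_segment d e : (forall t : R, 0 <= t <= 1 ->
    ((1 - t) * d.1 + t * e.1, (1 - t) * d.2 + t * e.2) != (0, 0)) ->
  low d -> low e.
Proof.
move=> n0; set f := fun t : R => (1 - t) * d.1 + t * e.1.
set g := fun t : R => (1 - t) * d.2 + t * e.2.
have fg0 : (f 0, g 0) = d by rewrite /f /g; case: (d) => d1 d2 /=; congr (_, _); ring.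
have fg1 : (f 1, g 1) = e by rewrite /f /g; case: (e) => e1 e2 /=; congr (_, _); ring.
rewrite -fg0 -fg1; apply: (segment_transfer (Q := fun t => low (f t, g t))).
move=> t It.
have cl (a b : R) : {for t, continuous (fun s : R => (1 - s) * a + s * b : R)}.
  apply: cvgD; apply: cvgM; try exact: cvg_cst; last exact: cvg_id.
  by apply: cvgB; [exact: cvg_cst|exact: cvg_id].
have := halfplane_near A (cl d.1 e.1) (cl d.2 e.2).
apply: filterS => s hs Is; split => [[H [hH cH lt]]|lowt].
  by exists H; split=> //; apply: hs.
(* Any halfplane at [s] is also one at [t], where all halfplanes of this size are low. *)
have [H hH cH] := halfplane_exists px py (f s, g s) nA.
by exists H; split=> //; apply: (low_all (n0 t It) lowt) => //; apply: hs.
Qed.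

Let low_any d e : d != (0, 0) -> e != (0, 0) -> low d -> low e.
Proof.
move=> d0 e0.
have pos (r : R * R) : r != (0, 0) -> 0 < r.1 ^+ 2 + r.2 ^+ 2.
  move=> r0; rewrite lt_neqAle addr_ge0 ?sqr_ge0 // andbT eq_sym.
  apply: contra r0; rewrite paddr_eq0 ?sqr_ge0 // !sqrf_eq0 => /andP[/eqP r1 /eqP r2].
  by case: r r1 r2 => ? ? /= -> ->.
(* If the angle is at most a right angle, the segment avoids 0: the squared norm of a point on it
   expands into nonnegative terms that do not all vanish. *)
have half (d' e' : R * R) : d' != (0, 0) -> e' != (0, 0) ->
    0 <= d'.1 * e'.1 + d'.2 * e'.2 -> low d' -> low e'.
  move=> d0' e0' de; apply: low_segment => t /andP[t0 t1].
  apply/eqP => -[e1 e2].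
  have pd := pos _ d0'; have pe := pos _ e0'.
  have sq : (1 - t) ^+ 2 * (d'.1 ^+ 2 + d'.2 ^+ 2) + t ^+ 2 * (e'.1 ^+ 2 + e'.2 ^+ 2) +
      2 * (t * (1 - t)) * (d'.1 * e'.1 + d'.2 * e'.2) = 0.
    transitivity (((1 - t) * d'.1 + t * e'.1) ^+ 2 + ((1 - t) * d'.2 + t * e'.2) ^+ 2).
      by ring.
    by rewrite e1 e2 expr0n addr0.
  have s0 : 0 <= (1 - t) ^+ 2 * (d'.1 ^+ 2 + d'.2 ^+ 2).
    by rewrite mulr_ge0 ?sqr_ge0 // ltW.
  have s1 : 0 <= 2 * (t * (1 - t)) * (d'.1 * e'.1 + d'.2 * e'.2).
    by rewrite mulr_ge0 // mulr_ge0 // mulr_ge0 // subr_ge0.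
  have [tz|tn] := eqVneq t 0.
    by move: sq; rewrite tz; lra.
  have : 0 < t ^+ 2 * (e'.1 ^+ 2 + e'.2 ^+ 2) by rewrite mulr_gt0 // exprn_gt0 // lt_neqAle eq_sym tn.
  lra.
have [de|de] := lerP 0 (d.1 * e.1 + d.2 * e.2); first exact: half.
(* The segment from [d] to [e] may contain 0: go through a direction perpendicular
   to [d]. *)
have [ce|ce] := lerP 0 (- d.2 * e.1 + d.1 * e.2).
  have r0 : (- d.2, d.1) != (0, 0).
    by apply: contra d0 => /eqP[/eqP]; rewrite oppr_eq0 => /eqP; case: (d) => ? ? /= -> ->.
  move=> /(half _ (- d.2, d.1) d0 r0) /= h; apply: (half (- d.2, d.1)) => //.
  by apply: h; lra.
have r0 : (d.2, - d.1) != (0, 0).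
  by apply: contra d0 => /eqP[+ /eqP]; rewrite oppr_eq0 => + /eqP; case: (d) => ? ? /= -> ->.
move=> /(half _ (d.2, - d.1) d0 r0) /= h; apply: (half (d.2, - d.1)) => //=; first by lra.
by apply: h; lra.
Qed.

Lemma halfplane_dichotomy :
  (forall d H, d != (0, 0) -> halfplane d A H -> #|H| = n -> (#|H :&: B| < x)%N) \/
  (forall d H, d != (0, 0) -> halfplane d A H -> #|H| = n -> (x < #|H :&: B|)%N).
Proof.
have [[d d0 ld]|none] := pselect (exists2 d, d != (0, 0) & low d).
  by left=> e H e0; apply: low_all => //; apply: low_any ld.
right=> d H d0 hH cH; have := avoid d0 hH cH.
have : ~~ (#|H :&: B| < x)%N by apply/negP => lt; apply: none; exists d => //; exists H.
lia.
Qed.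

End Dichotomy.

(** * Cutting into three parts *)

Section ThreeParts.
Import classical_sets filter topology normedtype.
Import numFieldNormedType.Exports.
Local Open Scope classical_set_scope.
Local Open Scope ring_scope.
Variables (R : realType) (T : finType) (px py : T -> R).
Implicit Types (d v : R * R) (H : {set T}) (W : {ffun T -> 'I_3}).
Local Notation dot := (dot px py).
Local Notation halfplane := (halfplane px py).
Hypothesis no3 : forall d (r : R), d != (0, 0) ->
  (#|[set z | dot d z == r]%SET| <= 2)%N.
Variables (A B : {set T}) (N x : 'I_3 -> nat).

(* Part 1 lies to the left of part 2, and part 0 is governed by [v], which ranges
   over [-1, 1] x [0, 1].  On the three sides where [width] vanishes part 0 is a
   halfplane; on the bottom side the parts are vertical strips, so that part 2 is
   a halfplane when [v.1 < width v] and part 1 is one when [- width v < v.1]. *)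
Let width v : R := (1 - v.1 ^+ 2) * (1 - v.2).
Let u v (i : 'I_3) : R * R :=
  match val i with 0%N => v | 1%N => (- width v, 0) | _ => (width v, 0) end.
Let a v i z := dot (u v i) z.
Let opt v := optimal A N (a v).

(** Gains depend continuously on the parameter, so an assignment that is strictly beaten at [v] is
    still beaten nearby, and there are finitely many assignments. *)
Let opt_near v : \forall v' \near v, forall W, opt v' W -> opt v W.
Proof.
apply: (@filter_forall _ {ffun T -> 'I_3} (fun W v' => is_true (opt v' W) -> is_true (opt v W)) (nbhs v) _) => W.
have [oW|nW] := pselect (opt v W); first exact: nearW.
have [sW|nsW] := boolP (sized A N W); last first.
  by apply: nearW => v' /andP[]; rewrite (negbTE nsW).
have [V sV lt] : exists2 V, sized A N V & gain A (a v) W < gain A (a v) V.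
  apply: contrapT => none; apply: nW; rewrite /opt /optimal sW /=.
  apply/forallP => V; apply/implyP => sV; rewrite leNgt; apply/negP => lt.
  by apply: none; exists V.
have c1 : (fun v' : R * R => v'.1) @ v --> v.1 by exact: cvg_fst.
have c2 : (fun v' : R * R => v'.2) @ v --> v.2 by exact: cvg_snd.
have cw : (fun v' : R * R => width v' : R) @ v --> width v.
  apply: cvgM; apply: cvgB => //; try exact: cvg_cst.
  by apply: cvgM.
have ca i z : (fun v' : R * R => a v' i z) @ v --> a v i z.
  apply: cvgD; apply: cvgM; try exact: cvg_cst.
    by rewrite /u; case: (val i) => [|[|n]] //=; apply: cvgN.
  by rewrite /u; case: (val i) => [|[|n]] //=; apply: cvg_cst.
have cg U : (fun v' : R * R => gain A (a v') U) @ v --> gain A (a v) U.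
  by apply: (cvg_big (op := +%R)) => [|z _]; [exact: add_continuous|exact: ca].
have c : (fun v' => gain A (a v') V - gain A (a v') W) @ v -->
   gain A (a v) V - gain A (a v) W by apply: cvgB; apply: cg.
have : \forall v' \near v, 0 < gain A (a v') V - gain A (a v') W.
  by apply: cvgr_gt c _ _; rewrite subr_gt0.
apply: filterS => v'; rewrite subr_gt0 => lt' /andP[_ /forallP/(_ V)/implyP/(_ sV)].
by rewrite leNgt lt'.
Qed.

Hypothesis N0 : forall i, (0 < N i)%N.
Hypothesis xN : forall i, (x i <= N i)%N.
Hypothesis sN : (\sum_i N i)%N = #|A|.
Hypothesis sx : (\sum_i x i)%N = #|A :&: B|.
Hypothesis low : forall i d H, d != (0, 0) -> halfplane d A H -> #|H| = N i ->
  (#|H :&: B| < x i)%N.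

Let red W i := cnt (A :&: B) W i.
Let i0 : 'I_3 := ord0.
Let i1 : 'I_3 := Ordinal (isT : 1 < 3)%N.
Let i2 : 'I_3 := Ordinal (isT : 2 < 3)%N.

Let sum3 (F : 'I_3 -> nat) : (\sum_i F i = F i0 + F i1 + F i2)%N.
Proof.
rewrite !big_ord_recl big_ord0 addn0 addnA.
by congr (F _ + F _ + F _)%N; apply: val_inj.
Qed.

Let part_low v W i d : opt v W -> d != (0, 0) ->
  (forall j, j != i -> exists2 m : R, 0 < m &
     u v i = ((u v j).1 + m * d.1, (u v j).2 + m * d.2)) -> (red W i < x i)%N.
Proof.
move=> oW d0 du; have hW := optimal_halfplane oW du.
have cW : #|[set z in A | W z == i]%SET| = N i.
  by case/andP: oW => /forallP/(_ i)/eqP.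
apply: leq_ltn_trans (low d0 hW cW); apply: subset_leq_card.
by apply/fintype.subsetP => z; rewrite !inE => /andP[/andP[-> ->] ->].
Qed.

Let top_low v W : opt v W -> width v = 0 -> v != (0, 0) -> (red W i0 < x i0)%N.
Proof.
move=> oW w0 v0; apply: (part_low oW v0); apply: ord3_ind => // _; exists 1 => //;
  by rewrite /u /= w0 ?oppr0 !mul1r !add0r; case: (v).
Qed.

Let right_low v W : opt v W -> v.2 = 0 -> v.1 < width v -> 0 < width v ->
  (red W i2 < x i2)%N.
Proof.
move=> oW v2 lt w0; apply: (part_low (d := (1, 0)) oW).
  by apply/eqP => -[] /eqP; rewrite oner_eq0.
apply: ord3_ind => // _.
  exists (width v - v.1); first by rewrite subr_gt0.
  by rewrite /u /= v2 mulr1 mulr0 addr0 subrKC.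
exists (width v + width v); first by rewrite addr_gt0.
by rewrite /u /= mulr1 mulr0 addr0 addKr.
Qed.

Let left_low v W : opt v W -> v.2 = 0 -> - width v < v.1 -> 0 < width v ->
  (red W i1 < x i1)%N.
Proof.
move=> oW v2 lt w0; apply: (part_low (d := (-1, 0)) oW).
  by apply/eqP => -[] /eqP; rewrite oppr_eq0 oner_eq0.
apply: ord3_ind => // _.
  exists (width v + v.1); first by lra.
  by rewrite /u /= v2; congr (_, _); ring.
exists (width v + width v); first by rewrite addr_gt0.
by rewrite /u /=; congr (_, _); ring.
Qed.

Let exact_parts W := [/\ sized A N W, forall i, red W i = x i &
  forall i j, i != j -> exists2 d, d != (0, 0) &
    forall y z, y \in A -> z \in A -> W y = i -> W z = j -> dot d z <= dot d y].

Let u_inj v : 0 < width v -> v != (- width v, 0) -> v != (width v, 0) ->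
  forall i j, i != j -> u v i != u v j.
Proof.
move=> w0 v1 v2.
have w1 : (- width v, 0) != (width v, 0) :> R * R by apply/eqP => -[]; lra.
by apply: ord3_ind; apply: ord3_ind => // _; rewrite /u /= // eq_sym.
Qed.

Lemma three_parts : exists W, exact_parts W.
Proof.
apply: contrapT => none.
have [sel optsel] := boolp.choice (fun v => optimal_exists (a v) sN).
have redN W : (red W i0 + red W i1 + red W i2 = x i0 + x i1 + x i2)%N.
  by have := sum_cnt (A :&: B) W; rewrite -sx !sum3.
pose K := [set v : R * R | -1 <= v.1 <= 1 /\ 0 <= v.2 <= 1].
have width0 v : K v -> 0 <= width v.
  by move=> [/andP[? ?] /andP[? ?]]; rewrite /width mulr_ge0 //; nra.
have width_ne v : K v -> width v = 0 -> v != (0, 0).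
  by move=> _ w0; apply/eqP => v0; move: w0; rewrite /width v0 /=; lra.
(* The sign of [v.1] matters near the points where [v] equals one of the two other
   directions: there ties are unbounded, but one label does not occur. *)
pose lab v := let W := sel v in
  if (red W i0 < x i0)%N then i0 else if v.1 <= 0
  then (if (red W i2 < x i2)%N then i2 else i1)
  else (if (red W i1 < x i1)%N then i1 else i2).
(* An exact optimal partition would do unless two of the three directions coincide,
   and in that case some part is a halfplane. *)
have inexact v W : K v -> opt v W -> red W i0 = x i0 -> red W i1 = x i1 ->
    red W i2 = x i2 -> False.
  move=> Kv oW e0 e1 e2.
  have w0 : 0 < width v.
    rewrite lt_neqAle width0 // andbT eq_sym; apply/eqP => w0.
    by have := top_low oW w0 (width_ne v Kv w0); rewrite e0 ltnn.
  apply: none; exists W; split.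
  - by case/andP: oW.
  - exact: ord3_ind.
  - move=> i j ij; exists ((u v i).1 - (u v j).1, (u v i).2 - (u v j).2).
      have : u v i != u v j.
        apply: u_inj ij => //; apply/eqP => vE.
          have := right_low oW; rewrite vE /= -vE => /(_ erefl).
          by rewrite e2 ltnn => /(_ _ w0) H; suff : false by []; apply: H; lra.
        have := left_low oW; rewrite vE /= -vE => /(_ erefl).
        by rewrite e1 ltnn => /(_ _ w0) H; suff : false by []; apply: H; lra.
      apply: contra => /eqP[/eqP]; rewrite subr_eq0 => /eqP E1 /eqP.
      rewrite subr_eq0 => /eqP E2; apply/eqP.
      by case: (u v i) (u v j) E1 E2 => ? ? [? ?] /= -> ->.
    move=> y z yA zA Wy Wz; have := optimal_swap oW yA zA.
    by rewrite Wy Wz /a /dot /=; lra.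
(* The total number of red points is right and not all parts are exact, so some part is short. *)
have lab_low v : K v -> (red (sel v) (lab v) < x (lab v))%N.
  move=> Kv; have := inexact v _ Kv (optsel v); have := redN (sel v); rewrite /lab.
  case: ifP => // /negbT r0; case: ifP => _; case: ifP => // /negbT r1 eqr ne;
    rewrite ltnNge; apply/negP => r2; apply: ne; lia.
have compactK : compact K.
  have -> : K = `[-1, 1] `*` `[0, 1].
    by apply/seteqP; split=> v; rewrite /K /= !in_itv.
  by apply: compact_setX; apply: segment_compact.
(* In this neighborhood optimal partitions are also optimal at [v], and a nonzero [v.1] keeps its
   sign. *)
pose U v := [set v' : R * R | (forall W, opt v' W -> opt v W) /\
  ((v.1 < 0 -> v'.1 < 0) /\ (0 < v.1 -> 0 < v'.1))].
have nbhsU v : K v -> nbhs v (U v).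
  move=> _; have c1 : (fun v' : R * R => v'.1) @ v --> v.1 by exact: cvg_fst.
  have lt0 : \forall v' \near v, v.1 < 0 -> v'.1 < 0.
    by apply: near_imply => v0; apply: cvgr_lt c1 _ v0.
  have gt0 : \forall v' \near v, 0 < v.1 -> 0 < v'.1.
    by apply: near_imply => v0; apply: cvgr_gt c1 _ v0.
  exact: filterI (opt_near v) (filterI lt0 gt0).
have [e e0 eU] := lebesgue_number compactK nbhsU.
(* The bound 2 makes the mesh [h] at most 1/2, so that [h < 1 - h ^+ 2], the width at the first grid
   point right of the middle. *)
have [M [M2 Me]] : exists M : nat, (2 <= M)%N /\ M%:R^-1 < e.
  exists (Num.bound e^-1).+2; split=> //.
  rewrite invf_plt ?posrE // (lt_trans (archi_boundP _)) ?invr_ge0 1?ltW //.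
  by rewrite ltr_nat ltnS leqnSn.
have M0 : 0 < M%:R :> R by rewrite ltr0n; lia.
pose grid p q : R * R := (p%:R / M%:R - 1, q%:R / M%:R).
have gridK p q : (p <= M + M)%N -> (q <= M)%N -> K (grid p q).
  move=> pM qM; rewrite /K /= lerBrDr addNr divr_ge0 ?ler0n //=.
  rewrite lerBlDr !ler_pdivrMr // mul1r -[1 + 1]/(2%:R) -natrM !ler_nat mul2n -addnn.
  by rewrite pM qM divr_ge0 ?ler0n.
have top v : K v -> width v = 0 -> lab v = i0.
  by move=> Kv w0; rewrite /lab (top_low (optsel v) w0 (width_ne v Kv w0)).
have := @sperner (fun p q => lab (grid p q)) (M + M) M.
case.
- move=> q qM; split; apply: top; try by apply: gridK; rewrite ?leq_addr.
    by rewrite /width /= mul0r sub0r sqrrN expr1n subrr mul0r.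
  by rewrite /width /= natrD [(_ + _) / _]mulrDl divff ?gt_eqF // addrK expr1n subrr mul0r.
- by move=> p pM; apply: top; [apply: gridK|rewrite /width /= divff ?gt_eqF // subrr mulr0].
- have grid2 p : (grid p 0).2 = 0 by rewrite /= mul0r.
  have widthP p : (p <= M + M)%N -> lab (grid p 0) != i0 -> 0 < width (grid p 0).
    move=> pM; rewrite lt_neqAle width0 ?andbT; last exact: gridK.
    by apply: contra => /eqP w0; apply/eqP/top; [apply: gridK|rewrite -w0].
  (* On the bottom side the nonzero labels are 2 up to column [M] and 1 after it, and columns [M]
     and [M.+1] have nonzero labels. So the only edge between labels 1 and 2 joins these two
     columns. *)
  have left p : (p <= M)%N -> lab (grid p 0) != i0 -> lab (grid p 0) = i2.
    move=> pM ne0; have w0 := widthP p (leq_trans pM (leq_addr _ _)) ne0.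
    have p0 : (grid p 0).1 <= 0 by rewrite /= subr_le0 ler_pdivrMr // mul1r ler_nat.
    have := right_low (optsel (grid p 0)) (grid2 p) (le_lt_trans p0 w0) w0.
    by move: ne0; rewrite /lab p0; case: ifP => // _ _ ->.
  have right p : (M < p <= M + M)%N -> lab (grid p 0) != i0 -> lab (grid p 0) = i1.
    move=> /andP[Mp pM] ne0; have w0 := widthP p pM ne0.
    have p0 : 0 < (grid p 0).1 by rewrite /= subr_gt0 ltr_pdivlMr // mul1r ltr_nat.
    have wp : - width (grid p 0) < (grid p 0).1 by apply: lt_trans p0; rewrite oppr_lt0.
    have := left_low (optsel (grid p 0)) (grid2 p) wp w0.
    by move: ne0; rewrite /lab leNgt p0 /=; case: ifP => // _ _ ->.
  have middle p : (grid p 0).1 < width (grid p 0) -> - width (grid p 0) < (grid p 0).1 ->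
      0 < width (grid p 0) -> lab (grid p 0) != i0.
    move=> wr wl w0; have := right_low (optsel _) (grid2 p) wr w0.
    have := left_low (optsel _) (grid2 p) wl w0; have := redN (sel (grid p 0)).
    rewrite /lab; case: ifP => [|_ _ -> ->]; first by lia.
    by case: ifP.
  pose h : R := M%:R^-1.
  have h0 : 0 < h by rewrite invr_gt0.
  have h1 : h <= 1 / 2 by rewrite div1r lef_pV2 ?posrE // ler_nat.
  have MM : M%:R / M%:R = 1 :> R by rewrite divff ?gt_eqF.
  have labM : lab (grid M 0) = i2.
    by apply: left => //; apply: middle; rewrite /width /= MM mul0r; lra.
  have labM1 : lab (grid M.+1 0) = i1.
    have gE : grid M.+1 0 = (h, 0).
      by rewrite /grid -addn1 natrD mulrDl MM mul0r mul1r [1 + _]addrC addrK.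
    by apply: right; [lia|apply: middle; rewrite gE /width /=; nra].
  have Mr : M \in index_iota 0 (M + M) by rewrite mem_index_iota leq0n -addn1 leq_add2l; apply: ltnW.
  rewrite (bigD1_seq M Mr) ?iota_uniq //=.
  rewrite labM labM1 /= big1_seq ?addn0 // => p /andP[pM]; rewrite mem_index_iota => pMM.
  apply/eqP; rewrite eqb0; apply/negP => /and3P[ne0 ne1 /eqP]; apply.
  have [ltp|gep] := ltnP p M.
    exact: etrans (left p (ltnW ltp) ne0) (esym (left p.+1 ltp ne1)).
  have [r0 r1] : (M < p <= M + M)%N /\ (M < p.+1 <= M + M)%N.
    by move: pM gep pMM; clear; lia.
  exact: etrans (right p r0 ne0) (esym (right p.+1 r1 ne1)).
move=> p [q [pM qM cell]].
have Kz : K (grid p q) by apply: gridK; exact: ltnW.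
have [z Kz0 sub] := eU _ Kz.
have vertex i : exists v, [/\ K v, U z v & lab v = i].
  have [da [db labi]] := cell i; exists (grid (da + p)%N (db + q)%N); split=> //.
    by apply: gridK; [case: (da)|case: (db)]; rewrite ?add0n ?add1n // ltnW.
  apply: sub; have near1 (b : bool) r : `|r%:R / M%:R - (b + r)%N%:R / M%:R| < e.
    rewrite natrD mulrDl opprD addrCA subrr addr0 normrN ger0_norm ?divr_ge0 //.
    by case: b; rewrite ?mul1r ?mul0r.
  split; rewrite /ball /= ; last exact: near1.
  by rewrite opprB addrA subrK; exact: near1.
have [v0 [Kv0 [opt0 _] lab0]] := vertex i0.
have [v1 [Kv1 [opt1 [neg1 _]] lab1]] := vertex i1.
have [v2 [Kv2 [opt2 [_ pos2]] lab2]] := vertex i2.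
have {}opt0 := opt0 _ (optsel v0); have {}opt1 := opt1 _ (optsel v1).
have {}opt2 := opt2 _ (optsel v2).
have wz : 0 < width z.
  rewrite lt_neqAle width0 // andbT eq_sym; apply/eqP => w0.
  have := top_low opt1 w0 (width_ne z Kz0 w0) => lt.
  by move: lab1; rewrite /lab lt.
(* Here parts 0 and 1 would have equal directions. Part 2 is then a halfplane, hence short in every
   partition optimal at [z], in particular in [sel v1]; as [v1.1] is negative, the label of [v1]
   could not be 1. *)
have z1 : z != (- width z, 0).
  apply/eqP => zE; have z1 : z.1 = - width z by rewrite [in LHS]zE.
  have lt : (red (sel v1) i2 < x i2)%N.
    by apply: (right_low opt1) => //; [rewrite zE|lra].
  have n1 : v1.1 < 0 by apply: neg1; lra.
  by move: lab1; rewrite /lab lt (ltW n1); case: ifP.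
have z2 : z != (width z, 0).
  apply/eqP => zE; have z2 : z.1 = width z by rewrite [in LHS]zE.
  have lt : (red (sel v2) i1 < x i1)%N.
    by apply: (left_low opt2) => //; [rewrite zE|lra].
  have p2 : 0 < v2.1 by apply: pos2; lra.
  by move: lab2; rewrite /lab lt leNgt p2; case: ifP.
apply: none; apply: (separated_exact no3 (u_inj wz z1 z2) N0 xN sx); apply: ord3_ind.
- by exists (sel v0) => //; have := lab_low v0 Kv0; rewrite lab0.
- by exists (sel v1) => //; have := lab_low v1 Kv1; rewrite lab1.
- by exists (sel v2) => //; have := lab_low v2 Kv2; rewrite lab2.
Qed.

End ThreeParts.

(** * The induction *)

Section Partition.
Local Open Scope nat_scope.
Variables (R : realType) (T : finType) (px py : T -> R).
Implicit Types (d : R * R) (A H Y Z : {set T}) (s : seq {set T}).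
Local Notation dot := (dot px py).
Local Notation halfplane := (halfplane px py).
Hypothesis no3 : forall d (r : R), d != (0, 0)%R ->
  #|[set z | dot d z == r]| <= 2.
Variables (B : {set T}) (k c : nat).
Hypothesis c0 : 0 < c.
Hypothesis ck : c < k.

(** Both sets may have points on the separating line, so disjointness is demanded separately. The
    value is boolean for use with [pairwise]. *)
Definition line_separated Y Z : bool := [disjoint Y & Z] &&
  `[< exists2 d, d != (0, 0)%R &
      forall y z, y \in Y -> z \in Z -> (dot d z <= dot d y)%R >].

Lemma line_separatedS Y Z Y' Z' : Y' \subset Y -> Z' \subset Z ->
  line_separated Y Z -> line_separated Y' Z'.
Proof.
move=> sY sZ /andP[dis /asboolP[d d0 le]]; apply/andP; split.
  exact: disjointWl sY (disjointWr sZ dis).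
by apply/asboolP; exists d => // y z /(subsetP sY) yY /(subsetP sZ); apply: le.
Qed.

(** That the parts cover [A] follows by counting when [A] has [k * n] points. *)
Definition partitionable A n := exists s, [/\ size s = n,
  {in s, forall Y, [/\ Y \subset A, #|Y| = k & 0 < #|Y :&: B| < k]} &
  pairwise line_separated s].

Lemma partitionable_cat A1 A2 A n1 n2 : A1 \subset A -> A2 \subset A ->
  line_separated A1 A2 -> partitionable A1 n1 -> partitionable A2 n2 -> partitionable A (n1 + n2).
Proof.
move=> S1 S2 sep [s1 [c1 g1 p1]] [s2 [c2 g2 p2]]; exists (s1 ++ s2); split.
- by rewrite size_cat c1 c2.
- move=> Y; rewrite mem_cat => /orP[/g1|/g2] [sub ? ?]; split=> //.
    exact: subset_trans S1.
  exact: subset_trans S2.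
- rewrite pairwise_cat p1 p2 !andbT; apply/allrelP => Y Z /g1[sY _ _] /g2[sZ _ _].
  exact: line_separatedS sep.
Qed.

Lemma partitionable_cat3 A1 A2 A3 A n1 n2 n3 : A1 \subset A -> A2 \subset A -> A3 \subset A ->
  line_separated A1 A2 -> line_separated A1 A3 -> line_separated A2 A3 ->
  partitionable A1 n1 -> partitionable A2 n2 -> partitionable A3 n3 -> partitionable A (n1 + n2 + n3).
Proof.
move=> S1 S2 S3 s12 s13 s23 [s1 [c1 g1 p1]] [s2 [c2 g2 p2]] [s3 [c3 g3 p3]].
exists (s1 ++ s2 ++ s3); split.
- by rewrite !size_cat c1 c2 c3 addnA.
- move=> Y; rewrite !mem_cat => /or3P[/g1|/g2|/g3] [sub ? ?]; split=> //;
    by [exact: subset_trans S1|exact: subset_trans S2|exact: subset_trans S3].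
- rewrite !pairwise_cat p1 p2 p3 !andbT; apply/andP; split; apply/allrelP => Y Z.
    move=> /g1[sY _ _]; rewrite mem_cat => /orP[/g2|/g3] [sZ _ _].
      exact: line_separatedS s12.
    exact: line_separatedS s13.
  by move=> /g2[sY _ _] /g3[sZ _ _]; apply: line_separatedS s23.
Qed.

Lemma threshold_le n q : q <= n -> (0 < q -> c.+1 < k) -> c * n + q <= k * n.
Proof.
move=> qn; case: q qn => [|q] qn.
  by rewrite addn0 leq_mul2r (ltnW ck) orbT.
move=> /(_ isT) ck1; apply: leq_trans (_ : c.+1 * n <= _).
  by rewrite mulSn addnC leq_add2r.
by rewrite leq_mul2r (ltnW ck1) orbT.
Qed.

Lemma first_failure (P : nat -> Prop) m : P 1 -> ~ P m.+1 ->
  exists i, [/\ 0 < i, i <= m, P i & ~ P i.+1].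
Proof.
move=> P1; elim: m => [//|m IH] nP.
have [Pm|/IH[i [i0 im Pi nPi]]] := pselect (P m.+1); first by exists m.+1.
by exists i; split=> //; apply: leqW.
Qed.

(* [b] says whether halfplanes have too few or too many points of [B]. *)
Definition sided (b : bool) A n x := forall d H, d != (0, 0)%R ->
  halfplane d A H -> #|H| = n -> if b then #|H :&: B| < x else x < #|H :&: B|.

(** Too many red points means too few blue ones: for [b = false] the colors are exchanged and the
    targets become [N i - x i]. *)
Lemma three_parts_sided b A (N x : 'I_3 -> nat) :
  (forall i, 0 < N i) -> (forall i, x i <= N i) -> \sum_i N i = #|A| ->
  \sum_i x i = #|A :&: B| -> (forall i, sided b A (N i) (x i)) ->
  exists W : {ffun T -> 'I_3}, [/\ forall i, cnt A W i = N i,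
    forall i, cnt (A :&: B) W i = x i &
    forall i j, i != j ->
      line_separated [set z in A | W z == i] [set z in A | W z == j]].
Proof.
move=> N0 xN sN sx side.
have fin (W : {ffun T -> 'I_3}) : (forall i j, i != j -> exists2 d, d != (0, 0)%R &
    forall y z, y \in A -> z \in A -> W y = i -> W z = j -> (dot d z <= dot d y)%R) ->
    forall i j, i != j -> line_separated [set z in A | W z == i] [set z in A | W z == j].
  move=> sep i j ij; have [d d0 le] := sep i j ij; apply/andP; split.
    rewrite -setI_eq0; apply/eqP/setP => z; rewrite !inE.
    apply/negP => /andP[/andP[_ /eqP ei] /andP[_ /eqP ej]].
    by move: ij; rewrite -ei -ej eqxx.
  apply/asboolP; exists d => // y z; rewrite !inE => /andP[yA /eqP Wy] /andP[zA /eqP Wz].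
  exact: le.
case: b side => side.
  have [W [sW rW sep]] := three_parts no3 N0 xN sN sx side.
  by exists W; split; [move=> i; apply/eqP/(forallP sW)|exact: rW|exact: fin].
have cntC W i : cnt A W i = cnt (A :&: B) W i + cnt (A :&: ~: B) W i.
  rewrite !cntE (bigID [in B]) /=; congr (_ + _); apply: eq_bigl => z;
    by rewrite !inE.
have cardC H : #|H :&: ~: B| = #|H| - #|H :&: B|.
  by rewrite -(cardsID B H) addKn setDE.
have x'N i : N i - x i <= N i by apply: leq_subr.
have sx' : \sum_i (N i - x i) = #|A :&: ~: B|.
  by rewrite cardC -sN -sx sumnB.
have low i d H : d != (0, 0)%R -> halfplane d A H -> #|H| = N i ->
    #|H :&: ~: B| < N i - x i.
  move=> d0 hH cH; have := side i d H d0 hH cH; have := subset_leq_card (subsetIl H B).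
  by rewrite cardC cH; clear; lia.
have [W [sW rW sep]] := three_parts no3 N0 x'N sN sx' low.
have sW' i : cnt A W i = N i by apply/eqP/(forallP sW).
exists W; split; [exact: sW'| |exact: fin] => i.
have := cntC W i; have := rW i; have := xN i; rewrite sW'; clear; lia.
Qed.

Lemma near_equipartition n : forall A q, #|A| = k * n -> #|A :&: B| = c * n + q ->
  q <= n -> (0 < q -> c.+1 < k) -> partitionable A n.
Proof.
elim/ltn_ind: n => n IH A q cA rA qn ck1.
have [n0|n1] := ltnP n 2.
  case: n n0 cA rA qn {IH} => [|[|//]] _ cA rA qn; first by exists [::].
  exists [:: A]; split=> // Y; rewrite inE => /eqP ->; split=> //.
    by rewrite cA muln1.
  rewrite rA muln1; case: q qn ck1 {rA} => [|[|//]] _ ck1.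
    by rewrite addn0 c0 ck.
  by rewrite addn1 ck1.
(* A group of [m] islands takes [p] of the [q] surplus red points, so that neither the group nor the
   remaining [n - m] islands get more than one per island. *)
pose valid m p := [&& 0 < m, m < n, p <= q, p <= m & m + q <= n + p].
have validC m p : valid m p -> valid (n - m) (q - p).
  by rewrite /valid; clear; lia.
have kM m : m <= n -> k * m <= #|A| by move=> mn; rewrite cA leq_mul2l mn orbT.
have IHv A' m p : valid m p -> #|A'| = k * m -> #|A' :&: B| = c * m + p -> partitionable A' m.
  move=> /and5P[m0 mn pq pm _] cA' rA'; apply: (IH m mn A' p) => // p0.
  by apply: ck1; apply: leq_trans pq.
have compl d H m p : valid m p -> halfplane d A H -> #|H| = k * m ->
    #|A :\: H| = k * (n - m) /\ #|(A :\: H) :&: B| + #|H :&: B| = c * n + q.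
  move=> /and5P[m0 mn pq pm _] [HA _] cH; split.
    by rewrite cardsD (setIidPr HA) cA cH mulnBr.
  rewrite -rA addnC -(cardsID H (A :&: B)); congr (_ + _); apply: eq_card => z.
    by rewrite !inE; have := subsetP HA z; case: (z \in H) => [->|_]; rewrite ?andbF ?andbT.
  by rewrite !inE andbA.
have [[m [p [d [H [v d0 hH cH rH]]]]]|avoid] := pselect (exists m p d H,
    [/\ valid m p, d != (0, 0)%R, halfplane d A H, #|H| = k * m & #|H :&: B| = c * m + p]).
  have [cD rD] := compl _ _ _ _ v hH cH; have [HA sep] := hH.
  have vC := validC _ _ v.
  have eA : n = m + (n - m) by case/and5P: v => ? mn *; rewrite subnKC // ltnW.
  rewrite eA; apply: (partitionable_cat HA (subsetDl A H)).
  - apply/andP; split; first by rewrite -setI_eq0; apply/eqP/setP => z; rewrite !inE; case: (z \in H).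
    by apply/asboolP; exists d.
  - exact: IHv v cH rH.
  - apply: IHv vC cD _; move: rD v; rewrite rH /valid mulnBr; clear; nia.
have sided_or m p : valid m p -> forall b, sided b A (k * m) (c * m + p) \/
    sided (~~ b) A (k * m) (c * m + p).
  move=> v; have /and5P[_ mn _ _ _] := v.
  have [||low|high] := @halfplane_dichotomy R T px py no3 A B (k * m) (c * m + p).
  - exact: kM (ltnW mn).
  - by move=> d H d0 hH cH rH; apply: avoid; exists m, p, d, H.
  - by case; [left|right].
  - by case; [right|left].
have d10 : (1, 0)%R != (0, 0)%R :> R * R by apply/eqP => -[] /eqP; rewrite oner_eq0.
have opp0 d : d != (0, 0)%R -> (- d.1, - d.2)%R != (0, 0)%R.
  by apply: contra => /eqP[/eqP + /eqP]; rewrite !oppr_eq0; case: d => ? ? /= /eqP-> /eqP->.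
(* The complement of a halfplane with too few red points is a halfplane with too many, so
   complementary groups err on opposite sides. *)
have sidedN b m p : valid m p -> sided b A (k * m) (c * m + p) ->
    ~ sided b A (k * (n - m)) (c * (n - m) + (q - p)).
  move=> v sb sb'; have /and5P[_ mn _ _ _] := v.
  have [H hH cH] := halfplane_exists px py (1, 0)%R (kM m (ltnW mn)).
  have [cD rD] := compl _ _ _ _ v hH cH.
  have := sb _ _ d10 hH cH; have := sb' _ _ (opp0 _ d10) (halfplane_compl hH) cD.
  by move: rD v; rewrite /valid mulnBr; case: (b) => /=; clear; nia.
have sidedC b m p : valid m p -> sided (~~ b) A (k * m) (c * m + p) ->
    sided b A (k * (n - m)) (c * (n - m) + (q - p)).
  move=> v sb d H d0 hH cH; have vC := validC _ _ v; have /and5P[_ mn _ _ _] := v.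
  have [cD rD] := compl _ _ _ _ vC hH cH; rewrite subKn ?(ltnW mn) // in cD.
  have := sb _ _ (opp0 _ d0) (halfplane_compl hH) cD.
  by move: rD v; rewrite /valid mulnBr; case: (b) => /=; clear; nia.
(* As many surplus red points as [m] islands can take; this choice is always admissible. *)
pose t m := minn m q.
have vt m : 0 < m -> m < n -> valid m (t m) by rewrite /valid /t; lia.
have [b sb1] : exists b, sided b A (k * 1) (c * 1 + t 1).
  by have [s1|s1] := sided_or 1 (t 1) (vt 1 isT n1) true; [exists true|exists false].
(* For one island the surplus is 0 or 1. When both are admissible, halfplanes of [k] points avoid
   two consecutive red counts and so err on the same side of both. *)
have single p : valid 1 p -> sided b A (k * 1) (c * 1 + p).
  move=> v d H d0 hH cH; have := sb1 d H d0 hH cH.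
  have ne : #|H :&: B| <> c * 1 + p by move=> rH; apply: avoid; exists 1, p, d, H.
  by move: ne v; rewrite /valid /t; case: (b) => /=; clear; lia.
(* The complement of a group of [n - 1] islands is a single island, which errs on side [b], so the
   group does not. Hence the side changes between some [i] and [i.+1]. *)
have nSn : ~ sided b A (k * (n - 2).+1) (c * (n - 2).+1 + t (n - 2).+1).
  have v : valid (n - 2).+1 (t (n - 2).+1) by apply: vt => //; lia.
  move=> s; have := sidedN b _ _ v s; apply.
  have e1 : n - (n - 2).+1 = 1 by lia.
  by rewrite e1; apply: single; have := validC _ _ v; rewrite e1.
have [i [i0 im Si nSi]] :=
  first_failure (P := fun i => sided b A (k * i) (c * i + t i)) sb1 nSn.
have vi : valid i (t i) by apply: vt => //; lia.
have vi1 : valid i.+1 (t i.+1) by apply: vt => //; lia.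
have vC := validC _ _ vi1.
have {}nSi : sided (~~ b) A (k * i.+1) (c * i.+1 + t i.+1).
  by have [//|] := sided_or _ _ vi1 b.
have S3 := sidedC _ _ _ vi1 nSi.
have v1 : valid 1 (t i.+1 - t i) by move: vi vi1; rewrite /valid /t; clear; lia.
(* The third group is the complement of the first [i.+1] islands, where the side is opposite, so it
   errs on side [b] like the other two. The surpluses add up to [q]. *)
pose m_ (j : 'I_3) := nth 0 [:: 1; i; n - i.+1] j.
pose p_ (j : 'I_3) := nth 0 [:: t i.+1 - t i; t i; q - t i.+1] j.
have vj j : valid (m_ j) (p_ j) by case: j => [[|[|[|//]]] ?].
have sum3 (F : 'I_3 -> nat) : \sum_j F j = F ord0 + F (lift ord0 ord0) + F (lift ord0 (lift ord0 ord0)).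
  by rewrite !big_ord_recl big_ord0 addn0 addnA.
have sm : \sum_j m_ j = n by rewrite sum3 /m_ /=; lia.
have sp : \sum_j p_ j = q by rewrite sum3 /p_ /= /t; lia.
have [||||j|W [sW rW sep]] := @three_parts_sided b A (fun j => k * m_ j) (fun j => c * m_ j + p_ j).
- move=> j; have /and5P[m0 _ _ _ _] := vj j; rewrite muln_gt0 m0 andbT.
  exact: leq_ltn_trans ck.
- move=> j; have /and5P[m0 _ pq pm _] := vj j; apply: threshold_le => // p0.
  by apply: ck1; apply: leq_trans pq.
- by rewrite -big_distrr /= sm.
- by rewrite big_split /= -big_distrr /= sm sp.
- have := vj j; case: j => [[|[|[|//]]] lt3] _; [exact: single|exact: Si|exact: S3].
have gj j : partitionable [set z in A | W z == j] (m_ j).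
  apply: IHv (vj j) (sW j) _; rewrite -rW; apply: eq_card => z.
  by rewrite !inE andbAC.
have Sj j : [set z in A | W z == j] \subset A by apply/subsetP => z; rewrite inE => /andP[].
rewrite -sm sum3; apply: (partitionable_cat3 (Sj _) (Sj _) (Sj _)) (gj _) (gj _) (gj _);
  by apply: sep.
Qed.

End Partition.

From mathcomp Require Import boolp classical_sets reals convex.
From mathcomp Require Import interval_inference.

(** * Convex hulls *)

Section Hulls.
Local Open Scope classical_set_scope.
Local Open Scope ring_scope.
Variables (R : realType).
Local Notation point := 'rV[R]_2.

Definition linear_form (d : R * R) (p : point) : R := d.1 * p 0 0 + d.2 * p 0 1.

Lemma linear_form_conv d (x y : convex_lmodType point) (l : {i01 R}) :
  linear_form d (conv l x y) = l%:num * linear_form d x + (1 - l%:num) * linear_form d y.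
Proof. by rewrite /linear_form /conv /= !mxE /mathcomp.classical.unstable.onem; ring. Qed.

(** An open halfplane stays convex when one boundary point is added. This handles a hull that
    touches the separating line at a single vertex. *)
Lemma convex_ray d (y0 : point) :
  convex_set [set p : convex_lmodType point | linear_form d y0 < linear_form d p \/ p = y0].
Proof.
apply/convex_setW => x y; rewrite !inE /= => hx hy k k0 k1; rewrite inE /=.
have [->|nx] := pselect (x = y0).
  have [->|ny] := pselect (y = y0); first by rewrite convmm; right.
  case: hy => // ly; left; rewrite linear_form_conv; nra.
case: hx => // lx; left; rewrite linear_form_conv.
have : linear_form d y0 <= linear_form d y by case: hy => [/ltW|->].
nra.
Qed.

Lemma convex_lt d (r : R) : convex_set [set p : convex_lmodType point | r < linear_form d p].
Proof.
apply/convex_setW => x y; rewrite !inE /= => hx hy k k0 k1; rewrite inE /= linear_form_conv; nra.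
Qed.

Lemma convex_le d (r : R) : convex_set [set p : convex_lmodType point | r <= linear_form d p].
Proof.
apply/convex_setW => x y; rewrite !inE /= => hx hy k k0 k1; rewrite inE /= linear_form_conv; nra.
Qed.

Lemma conv_hull_sub (Y : {fset point}) (S : set (convex_lmodType point)) :
  convex_set S -> (forall y, y \in Y -> S y) -> conv_hull Y `<=` S.
Proof. by move=> cS YS; apply: smallest_sub => // y /= yY; apply: YS. Qed.

(** Three collinear points are affinely dependent; the coordinate [t] along the line provides the
    weights. *)
Lemma general_position_no3 (X : {fset point}) : general_position X ->
  forall d (r : R), d != (0, 0) ->
  (#|[set z : X | (d.1 * (val z) 0 0 + d.2 * (val z) 0 1 == r)%R]%SET| <= 2)%N.
Proof.
move=> gp d r d0; rewrite leqNgt; apply/negP => /card_gt2P[p [q [s [[]]]]].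
rewrite !inE => /eqP ep /eqP eq /eqP es [pq qs sp].
pose t (z : point) := - d.2 * z 0 0 + d.1 * z 0 1.
pose P := val p; pose Q := val q; pose S := val s.
have nPQ : P != Q by [].
have nQS : Q != S by [].
have nSP : S != P by [].
(* In the affine dependence of [P], [Q], [S] each point has as its weight the
   signed distance of the other two. *)
pose a (z : point) := if z == P then t Q - t S else if z == Q then t S - t P else t P - t Q.
pose Y := [fset P; Q; S]%fset.
have sumY (V : zmodType) (F : point -> V) : \sum_(y <- Y) F y = F P + F Q + F S.
  rewrite /Y fsetUC big_fsetU1 /=; last by rewrite !inE negb_or nSP eq_sym nQS.
  by rewrite big_fsetU1 ?inE //= big_seq_fset1 addrC.
have aP : a P = t Q - t S by rewrite /a eqxx.
have aQ : a Q = t S - t P by rewrite /a eq_sym (negbTE nPQ) eqxx.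
have aS : a S = t P - t Q by rewrite /a (negbTE nSP) eq_sym (negbTE nQS).
have dd : 0 < d.1 ^+ 2 + d.2 ^+ 2.
  rewrite lt_neqAle addr_ge0 ?sqr_ge0 // andbT eq_sym.
  apply: contra d0; rewrite paddr_eq0 ?sqr_ge0 // !sqrf_eq0 => /andP[/eqP r1 /eqP r2].
  by case: d r1 r2 {ep eq es t a aP aQ aS} => ? ? /= -> ->.
(* The form [d] and its rotation by a right angle determine a point: their determinant is the
   squared norm of [d]. *)
have rot (z w : point) : d.1 * z 0 0 + d.2 * z 0 1 = d.1 * w 0 0 + d.2 * w 0 1 ->
    t z = t w -> z = w.
  rewrite /t => h1 h2; apply/rowP => j.
  have k1 : d.1 * (z 0 0 - w 0 0) + d.2 * (z 0 1 - w 0 1) = 0 by lra.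
  have k2 : - d.2 * (z 0 0 - w 0 0) + d.1 * (z 0 1 - w 0 1) = 0 by lra.
  have e0 : (d.1 ^+ 2 + d.2 ^+ 2) * (z 0 0 - w 0 0) = 0.
    transitivity (d.1 * (d.1 * (z 0 0 - w 0 0) + d.2 * (z 0 1 - w 0 1)) -
      d.2 * (- d.2 * (z 0 0 - w 0 0) + d.1 * (z 0 1 - w 0 1))); first ring.
    by rewrite k1 k2 !mulr0 subr0.
  have e1 : (d.1 ^+ 2 + d.2 ^+ 2) * (z 0 1 - w 0 1) = 0.
    transitivity (d.2 * (d.1 * (z 0 0 - w 0 0) + d.2 * (z 0 1 - w 0 1)) +
      d.1 * (- d.2 * (z 0 0 - w 0 0) + d.1 * (z 0 1 - w 0 1))); first ring.
    by rewrite k1 k2 !mulr0 addr0.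
  move/eqP: e0; move/eqP: e1; rewrite !mulf_eq0 !(gt_eqF dd) /= !subr_eq0 => /eqP e1 /eqP e0.
  case: j => [[|[|//]] lt2].
    by rewrite (_ : Ordinal lt2 = 0) //; apply: val_inj.
  by rewrite (_ : Ordinal lt2 = 1) //; apply: val_inj.
have /(_ _ _ _ P) : affinely_independent Y.
  apply: gp; first by apply/fsubsetP => z; rewrite !inE => /orP[/orP[]|] /eqP->; apply: valP.
  rewrite /Y fsetUC cardfsU1 cardfs2; by case: (_ \notin _); case: (_ != _).
move=> /(_ a); rewrite !sumY aP aQ aS => H.
have : t Q - t S = 0.
  apply: H; last by rewrite !inE eqxx.
    by ring.
  have rowE (v : point) : v 0 0 = 0 -> v 0 1 = 0 -> v = 0.
    move=> v0 v1; apply/rowP => -[[|[|//]] lt2]; rewrite [RHS]mxE.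
      by rewrite (_ : Ordinal lt2 = 0) //; apply: val_inj.
    by rewrite (_ : Ordinal lt2 = 1) //; apply: val_inj.
  have zp z : linear_form d z = r -> linear_form d z - r = 0 by move=> ->; rewrite subrr.
  apply: rowE; rewrite !mxE /t.
    transitivity ((Q 0 1 - S 0 1) * (linear_form d P - r) + (S 0 1 - P 0 1) * (linear_form d Q - r) +
      (P 0 1 - Q 0 1) * (linear_form d S - r)); first by rewrite /linear_form; ring.
    by rewrite !zp // !mulr0 !addr0.
  transitivity ((S 0 0 - Q 0 0) * (linear_form d P - r) + (P 0 0 - S 0 0) * (linear_form d Q - r) +
    (Q 0 0 - P 0 0) * (linear_form d S - r)); first by rewrite /linear_form; ring.
  by rewrite !zp // !mulr0 !addr0.
move/eqP; rewrite subr_eq0 => /eqP tQS; move: nQS; rewrite (rot Q S _ tQS) ?eqxx //.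
by rewrite eq es.
Qed.

Definition px (X : {fset point}) (z : X) : R := val z 0 0.
Definition py (X : {fset point}) (z : X) : R := val z 0 1.

Definition points (X : {fset point}) (Y : {set X}) : {fset point} :=
  [fset val z | z in Y]%fset.

Lemma in_points (X : {fset point}) (Y : {set X}) (z : X) :
  (val z \in points Y) = (z \in Y).
Proof.
apply/imfsetP/idP => [[y /= yY /val_inj ->] //|zY]; by exists z.
Qed.

(** Let [y] minimize the form on [Y]. If some [z] of [Z] lies on the same level line, that line
    holds no third point, so the hulls lie in opposite open halfplanes with [y] and [z] added.
    Otherwise [Z] lies strictly below the line. *)
Lemma hulls_disjoint (X : {fset point}) (Y Z : {set X}) : general_position X ->
  line_separated (px (X := X)) (py (X := X)) Y Z ->
  conv_hull (points Y) `&` conv_hull (points Z) = set0.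
Proof.
move=> gp /andP[dis /asboolP[d d0 sep]]; have no3 := general_position_no3 gp _ d0.
have dj w : w \in Y -> w \in Z -> False by move=> /(disjointFr dis) ->.
pose f (z : X) := linear_form d (val z).
have {}sep y z : y \in Y -> z \in Z -> f z <= f y by exact: sep.
have hull (V : {set X}) (S : set (convex_lmodType point)) : convex_set S ->
    (forall z, z \in V -> S (val z)) -> conv_hull (points V) `<=` S.
  by move=> cS VS; apply: conv_hull_sub => // y /imfsetP[z /= zV ->]; apply: VS.
apply/seteqP; split=> // p [hY hZ].
have [Y0|[y0 y0Y]] := set_0Vmem Y.
  have /(_ p hY) : conv_hull (points Y) `<=` set0.
    by apply: hull => [x y l|z]; rewrite ?Y0 ?inE // => /set_mem.
  by [].
case: (@arg_minP _ _ _ y0 (mem Y) f y0Y) => /= y; rewrite -/(is_true (y \in Y)) => yY miny.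
have opp z : linear_form (- d.1, - d.2) z = - linear_form d z by rewrite /linear_form /=; ring.
have [[z [zZ fz]]|none] := pselect (exists z, z \in Z /\ f z = f y).
  have yz : y != z by apply/eqP => e; apply: (dj y yY); rewrite e.
  have only w : f w = f y -> w = y \/ w = z.
    move=> fw; apply: contrapT => /not_orP[/eqP wy /eqP wz].
    have : (#|[set w; y; z]%SET| <= 2)%N.
      apply: leq_trans (no3 (f y)); apply: subset_leq_card.
      apply/fintype.subsetP => v; rewrite 3!inE => /orP[/orP[]|]; rewrite ?inE => /eqP ->;
        apply/eqP; [exact: fw|by []|exact: fz].
    by rewrite finset.setUC cardsU1 cards2 !inE negb_or wy ![z == _]eq_sym wz yz.
  have pY : linear_form d (val y) < linear_form d p \/ p = val y.
    refine (hull Y _ (@convex_ray d (val y)) _ p hY) => w wY /=.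
    have := miny w wY; rewrite le_eqVlt => /orP[/eqP e|]; last by left.
    have [->|wz] := only w (esym e); first by right.
    by case: (dj w wY); rewrite wz.
  have pZ : linear_form (- d.1, - d.2) (val z) < linear_form (- d.1, - d.2) p \/ p = val z.
    refine (hull Z _ (@convex_ray _ (val z)) _ p hZ) => w wZ /=; rewrite !opp ltrN2.
    have := sep y w yY wZ; rewrite le_eqVlt -fz => /orP[/eqP e|]; last by left.
    have [wy|->] := only w (etrans e fz); last by right.
    by case: (dj w _ wZ); rewrite wy.
  move: pZ; rewrite !opp ltrN2; move: fz; rewrite /f => fz.
  case: pY => [l1|->]; case => [l2|e].
  - by lra.
  - by move: l1; rewrite e fz ltxx.
  - by move: l2; rewrite fz ltxx.
  - by case/eqP: yz; apply: val_inj.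
have pY : f y <= linear_form d p.
  by refine (hull Y _ (@convex_le d (f y)) _ p hY) => w wY; apply: miny.
have pZ : - f y < linear_form (- d.1, - d.2) p.
  refine (hull Z _ (@convex_lt _ (- f y)) _ p hZ) => w wZ /=; rewrite opp ltrN2.
  rewrite lt_neqAle [_ <= _]sep // andbT; apply/eqP => e; apply: none.
  by exists w.
by move: pZ; rewrite opp ltrN2 ltNge pY.
Qed.

End Hulls.

(** * From separated parts to disjoint islands *)

Lemma card_cover (T : finType) (r : rel {set T}) (k : nat) (s : seq {set T}) :
  (forall Y Z, r Y Z -> [disjoint Y & Z]) -> (forall Y, Y \in s -> #|Y| = k) ->
  pairwise r s -> #|[set z | has (fun Y : {set T} => z \in Y) s]%SET| = (k * size s)%N.
Proof.
move=> dis; elim: s => [|Y s IH] cs /=.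
  rewrite muln0 (_ : [set _ | _]%SET = finset.set0) ?cards0 //.
move=> /andP[/allP rY /IH rs].
have -> : [set z | (z \in Y) || has (fun Y : {set T} => z \in Y) s]%SET =
    Y :|: [set z | has (fun Y : {set T} => z \in Y) s]%SET.
  by apply/setP => z; rewrite !inE.
rewrite cardsU rs; last by move=> Z Zs; apply: cs; rewrite in_cons Zs orbT.
rewrite (cs Y) ?mem_head // (_ : _ :&: _ = finset.set0) ?cards0 ?subn0 ?mulnS //.
apply/setP => z; rewrite !inE; apply/negP => /andP[zY /hasP[Z Zs zZ]].
by have := disjointFr (dis _ _ (rY Z Zs)) zY; rewrite zZ.
Qed.

Lemma card_points (R : realType) (X : {fset 'rV[R]_2}) (Y : {set X}) :
  #|` points Y| = #|Y|.
Proof.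
rewrite card_imfset; last exact: val_inj.
rewrite -(card_uniqP (enum_finmem_uniq _)); apply: eq_card => z.
by rewrite enum_finmemE.
Qed.

Theorem theorem1 (R : realType) (k n : nat)
    (X : {fset 'rV[R]_2}) (C : 'I_2 -> {fset 'rV[R]_2}) :
  (2 <= k)%N -> (1 <= n)%N ->
  general_position X ->
  coloring X C ->
  #|` X| = (k * n)%N ->
  (forall c : 'I_2, (n <= #|` C c|)%N) ->
  exists Y : 'I_n -> {fset 'rV[R]_2},
    (forall i : 'I_n, kisland k X (Y i) /\ colorful C 2 (Y i)) /\
    trivIset [set: 'I_n]%classic (fun i => conv_hull (Y i)).
Proof.
move=> k2 n1 gp [XC disC] cX nC.
pose o1 : 'I_2 := lift ord0 ord0.
have XC' : X = (C ord0 `|` C o1)%fset by rewrite XC !big_ord_recl big_ord0 fsetU0.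
have dis01 : [disjoint C ord0 & C o1]%fset by apply: disC.
have cX' : (#|` C ord0| + #|` C o1|)%N = (k * n)%N.
  by rewrite -cX XC' cardfsU (_ : (_ `&` _)%fset = fset0) ?cardfs0 ?subn0 //; apply/eqP.
pose B := [set z : X | val z \in C ord0]%SET.
have cB : #|B| = #|` C ord0|.
  rewrite -card_points; congr (size (enum_fset _)); apply/fsetP => z.
  apply/imfsetP/idP => [[y /=]|zC]; first by rewrite inE => yC ->.
  have zX : z \in X by rewrite XC' inE zC.
  by exists [` zX]%fset; rewrite //= inE.
have cT : #|[set: X]%SET| = (k * n)%N by rewrite cardsT -cX cardfE.
have rE := divn_eq #|` C ord0| n; set c := _ %/ n in rE; set q := _ %% n in rE.
have qn : (q < n)%N by rewrite ltn_mod.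
have n0 := nC ord0; have nn := nC o1.
(* Each color has at least [n] of the [k * n] points, so the number of red points lies between [n]
   and [(k - 1) * n]. Hence [c] is between 1 and [k - 1], and it equals [k - 1] only if [q = 0]. *)
have c0 : (0 < c)%N by rewrite divn_gt0.
have ck : (c < k)%N.
  rewrite ltn_divLR //; move: cX' nn n1; rewrite mulnC; clear; nia.
have ck1 : (0 < q)%N -> (c.+1 < k)%N.
  move=> q0; have : (c * n < (k - 1) * n)%N.
    by move: cX' nn rE q0 k2; rewrite mulnBl mul1n; clear; lia.
  by rewrite ltn_mul2r n1 /=; clear; lia.
have rT : #|[set: X]%SET :&: B| = (c * n + q)%N by rewrite finset.setTI cB rE.
have [s [ss gs ps]] := near_equipartition (general_position_no3 gp) c0 ck cT rT (ltnW qn) ck1.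
pose Y (i : 'I_n) := nth finset.set0 s i.
have Ys (i : 'I_n) : Y i \in s by rewrite mem_nth ?ss.
have cover : [set z | has (fun Y : {set X} => z \in Y) s]%SET = [set: X]%SET.
  apply/eqP; rewrite eqEcard finset.subsetT cT (card_cover _ _ ps (k := k)) ?ss ?leqnn //.
    by move=> U V /andP[].
  by move=> U /gs[].
have trivY : trivIset [set: 'I_n]%classic (fun i => conv_hull (points (Y i))).
  have lt (i j : 'I_n) : (i < j)%N ->
      (conv_hull (points (Y i)) `&` conv_hull (points (Y j)) = set0)%classic.
    move=> ij; apply: hulls_disjoint => //.
    by apply: (pairwiseP finset.set0 ps) => //; rewrite inE ss.
  move=> i j _ _ [p [pi pj]]; have [ij|ji|ij] := ltngtP (i : nat) (j : nat).
  - by have : classical_sets.set0 p by rewrite -(lt i j ij).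
  - by have : classical_sets.set0 p by rewrite -(lt j i ji).
  - exact: val_inj ij.
have sub_hull (U : {fset 'rV[R]_2}) : ([set` U] `<=` conv_hull U)%classic.
  exact: sub_gen_smallest.
exists (fun i => points (Y i)); split=> // i.
have [_ cY rY] := gs _ (Ys i); split; last first.
  rewrite /colorful.
  have [z zP] : exists z, z \in Y i :&: B.
    by apply/set0Pn; rewrite -card_gt0; case/andP: rY.
  have [w wP] : exists w, w \in Y i :\: B.
    apply/set0Pn; rewrite -card_gt0; have := cardsID B (Y i); rewrite cY.
    by case/andP: rY => _; clear; lia.
  rewrite (_ : [set _ | _]%SET = [set: 'I_2]%SET) ?cardsT ?card_ord //.
  apply/setP => j; rewrite !inE; apply/fset0Pn.
  case: j => [[|[|//]] lt2].
    rewrite (_ : Ordinal lt2 = ord0); last exact: val_inj.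
    by exists (val z); rewrite in_fsetI in_points; move: zP; rewrite !inE.
  rewrite (_ : Ordinal lt2 = o1); last exact: val_inj.
  exists (val w); rewrite in_fsetI in_points.
  move: wP; rewrite !inE => /andP[wC ->] /=.
  have XCP (z' : 'rV[R]_2) : z' \in X -> (z' \in C ord0) || (z' \in C o1).
    by rewrite XC' inE.
  by have := XCP _ (valP w); rewrite (negbTE wC).
split; last by rewrite card_points.
split; first by apply/fsubsetP => z /imfsetP[y /= _ ->]; apply: valP.
apply/seteqP; split=> [z [zX hz]|z zY]; last first.
  by split; [move: zY => /imfsetP[y /= _ ->]; apply: valP|apply: sub_hull].
(* The parts cover [X], so [z] lies in some part; the hull of that part meets the hull of [Y i] in
   [z], so the two parts coincide. *)
have : [` zX]%fset \in [set z | has (fun Y : {set X} => z \in Y) s]%SET.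
  by rewrite cover finset.in_setT.
rewrite inE => /hasP[U Us zU]; have /(nthP finset.set0)[j js Uj] := Us.
have jn : (j < n)%N by rewrite -ss.
have zU' : z \in points U by rewrite -[z]/(val [` zX]%fset) in_points.
have -> : i = Ordinal jn.
  apply: trivY => //; exists z; split=> //; apply: sub_hull.
  by rewrite /Y /= Uj; exact: zU'.
by rewrite /Y /= Uj; exact: zU'.
Qed.
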